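(* With the subalgebra $L_{A_1^{(1)}}(-\Lambda_0)\subset L_{A_1^{(1)}}(-\tfrac12\Lambda_0)\otimes L_{A_1^{(1)}}(-\tfrac12\Lambda_0)$ and the one-dimensional space $\mathfrak h=\mathbb C H$ described in the context, there is an isomorphism of vertex algebras $$\mathrm{Com}\big(L_{A_1^{(1)}}(-\Lambda_0),\ L_{A_1^{(1)}}(-\tfrac12\Lambda_0)\otimes L_{A_1^{(1)}}(-\tfrac12\Lambda_0)\big)\ \cong\ M_{\mathfrak h}(1)^+ .$$
   Context: All vertex algebras are over $\mathbb C$. For a vertex subalgebra $U\subset V$, $\mathrm{Com}(U,V)=\{v\in V \mid u_n v=0 \text{ for all } u\in U,\ n\ge 0\}$. $L_{A_1^{(1)}}(k\Lambda_0)$, $k\ne -2$, is the simple affine vertex operator algebra of level $k$ of type $A_1^{(1)}$. Heisenberg algebra: for a finite-dimensional space $\mathfrak h$ with nondegenerate symmetric bilinear form, $M_{\mathfrak h}(1)=S(\mathfrak h\otimes t^{-1}\mathbb C[t^{-1}])$ is the associated Heisenberg (free boson) vertex operator algebra of level 1, and $M_{\mathfrak h}(1)^+$ is the subalgebra of fixed points of the order-two automorphism lifted from $h\mapsto -h$, $h\in\mathfrak h$. Weyl vertex algebra $M_m$: the algebra with generators $a_i^\pm(r)$, $r\in\tfrac12+\mathbb Z$, $1\le i\le m$, and only non-trivial relations $[a_i^+(r),a_j^-(s)]=\delta_{r+s,0}\delta_{i,j}$ has an irreducible module $M_m$ generated by $\mathbf 1$ with $a_i^\pm(r)\mathbf 1=0$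 for $r>0$; the fields $a_i^\pm(z)=\sum_{n\in\mathbb Z}a_i^\pm(n+\tfrac12)z^{-n-1}$ generate on $M_m$ a unique simple vertex algebra structure. Let $M_m^0$ be the fixed points of the automorphism $a_i^\pm(r)\mapsto -a_i^\pm(r)$. It is known that $M_1^0\cong L_{A_1^{(1)}}(-\tfrac12\Lambda_0)$. In $M_2$ put $b_1^+=\tfrac1{\sqrt2}(a_1^+(-\tfrac12)+a_2^-(-\tfrac12))\mathbf 1$, $b_2^+=\tfrac{\sqrt{-1}}{\sqrt2}(a_1^+(-\tfrac12)-a_2^-(-\tfrac12))\mathbf 1$, $b_1^-=\tfrac1{\sqrt2}(a_1^-(-\tfrac12)-a_2^+(-\tfrac12))\mathbf 1$, $b_2^-=\tfrac{-\sqrt{-1}}{\sqrt2}(a_1^-(-\tfrac12)+a_2^+(-\tfrac12))\mathbf 1$. The subalgebras generated by $b_1^\pm$ and by $b_2^\pm$ are each isomorphic to $M_1$, and $M_2$ is their tensor product. Then $L_{A_1^{(1)}}(-\tfrac12\Lambda_0)\otimes L_{A_1^{(1)}}(-\tfrac12\Lambda_0)$ is identified with $M_1^0\otimes M_1^0\subset M_1\otimes M_1=M_2$ for this decomposition. The subalgebra $L_{A_1^{(1)}}(-\Lambda_0)$ is the subalgebra of $M_1^0\otimes M_1^0$ generated by $a_1^+(-\tfrac12)a_2^-(-\tfrac12)\mathbf 1$, $a_1^-(-\tfrac12)a_2^+(-\tfrac12)\mathbf 1$ and $(-a_1^+(-\tfrac12)a_1^-(-\tfrac12)+a_2^+(-\tfrac12)a_2^-(-\tfrac12))\mathbf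 1$. $\mathfrak h=\mathbb C H$ with $H=(a_1^+(-\tfrac12)a_1^-(-\tfrac12)+a_2^+(-\tfrac12)a_2^-(-\tfrac12))\mathbf 1\in M_2$ and $\langle H,H\rangle=-2$. *)

(* Defs.v *)
From HB Require Import structures.
From mathcomp Require Import all_boot all_order all_algebra.
From mathcomp Require Import complex.
From mathcomp Require Import finmap.
From mathcomp Require Import monalg.
From mathcomp Require Import boolp classical_sets functions reals.

Set Implicit Arguments.
Unset Strict Implicit.
Unset Printing Implicit Defensive.

Import Order.TTheory GRing.Theory Num.Theory.
Local Open Scope classical_set_scope.
Local Open Scope ring_scope.

(* x (x - 1) ... (x - i + 1) / i!, for a possibly negative integer x. *)
Definition gbinom (C : numClosedFieldType) (x : int) (i : nat) : C :=
  (\prod_(j < i) (x - j%:Z)%:~R) / (i`!)%:R.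

(* In all three sums of the Borcherds identity the terms vanish for i large, by
   mode_trunc; each infinite sum is therefore the common value of its large
   enough partial sums. *)
Definition borcherds_identity (C : numClosedFieldType) (V : lmodType C)
    (mode : V -> int -> V -> V) : Prop :=
  forall (u v w : V) (p q r : int),
  exists N0 : nat, forall N : nat, (N0 <= N)%N ->
    \sum_(i < N) gbinom C p i *: mode (mode u (r + i%:Z) v) (p + q - i%:Z) w =
    \sum_(i < N) ((-1) ^+ i * gbinom C r i) *:
       (mode u (p + r - i%:Z) (mode v (q + i%:Z) w)
        - (-1) ^ r *: mode v (q + r - i%:Z) (mode u (p + i%:Z) w)).

(* mode u n v is the n-th product u_n v, Y(u, z) = \sum_n u_n z^(-n-1). *)
Record vertexAlgebra (C : numClosedFieldType) := VertexAlgebra {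
  va_sort :> lmodType C;
  vac : va_sort;
  mode : va_sort -> int -> va_sort -> va_sort;
  mode_linearl : forall n v, linear (fun u => mode u n v);
  mode_linearr : forall u n, linear (mode u n);
  mode_trunc : forall u v, exists N : int, forall n, N <= n -> mode u n v = 0;
  mode_vacl : forall n v, mode vac n v = if n == -1 then v else 0;
  mode_vacr : forall u, mode u (-1) vac = u;
  mode_vacr0 : forall u n, 0 <= n -> mode u n vac = 0;
  mode_borcherds : borcherds_identity mode }.

Arguments vac {C} _.
Arguments mode {C _} _ _ _.

Section Subalgebras.
Variables (C : numClosedFieldType) (V : vertexAlgebra C).
Implicit Types (A B U G : set V).

Definition is_subspace A : Prop :=
  A 0 /\ forall (c : C) u v, A u -> A v -> A (c *: u + v).

Definition vertex_subalgebra U : Prop :=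
  [/\ is_subspace U, U (vac V) & forall u n v, U u -> U v -> U (mode u n v)].

Definition linear_span G : set V := smallest is_subspace G.

Definition generated G : set V := smallest vertex_subalgebra G.

(* Commutant of U in the vertex subalgebra A of the ambient algebra V. *)
Definition commutant U A : set V :=
  [set v | A v /\ forall u, U u -> forall n : int, 0 <= n -> mode u n v = 0].

(* For commuting subalgebras A and B of V such that the canonical map
   A (x) B -> V, u (x) v |-> u_{-1} v, is injective, this is A (x) B inside V. *)
Definition inner_tensor A B : set V :=
  linear_span [set x | exists u v, [/\ A u, B v & x = mode u (-1) v]].

End Subalgebras.

(* f is an isomorphism from the vertex subalgebra U of V onto the vertex
   subalgebra U' of V'; its values outside U are irrelevant. *)
Definition va_isomorphism (C : numClosedFieldType) (V V' : vertexAlgebra C)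
    (U : set V) (U' : set V') (f : V -> V') : Prop :=
  [/\ set_bij U U' f,
      forall (c : C) u v, U u -> U v -> f (c *: u + v) = c *: f u + f v,
      f (vac V) = vac V' &
      forall u n v, U u -> U v -> f (mode u n v) = mode (f u) n (f v)].

Definition va_isomorphic (C : numClosedFieldType) (V V' : vertexAlgebra C)
    (U : set V) (U' : set V') : Prop :=
  [/\ vertex_subalgebra U, vertex_subalgebra U' &
      exists f : V -> V', va_isomorphism U U' f].

(* Fixed points in U of the automorphism of U extending g |-> - g on G. If G
   generates U there is at most one such automorphism. *)
Definition neg_fixed (C : numClosedFieldType) (V : vertexAlgebra C)
    (U G : set V) : set V :=
  [set v | U v /\ exists th : V -> V,
     [/\ va_isomorphism U U th, forall g, G g -> th g = - g & th v = v]].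

Section Weyl.
Variables (C : numClosedFieldType).

(* ap i and am i are the vectors a_i^+(-1/2)1 and a_i^-(-1/2)1 of M_m. The
   operator a_i^+(n + 1/2) is mode (ap i) n, so a_i^+(r) with r > 0 means n >= 0
   and r + s = 0 means that the two mode indices add up to -1. *)
Definition weyl_stable m (V : vertexAlgebra C) (ap am : 'I_m -> V)
    (A : set V) : Prop :=
  is_subspace A /\
  forall i n v, A v -> A (mode (ap i) n v) /\ A (mode (am i) n v).

Definition weyl_vertex_algebra m (V : vertexAlgebra C) (ap am : 'I_m -> V)
    : Prop :=
  [/\ [/\ forall i j k l v,
            mode (ap i) k (mode (am j) l v) - mode (am j) l (mode (ap i) k v)
            = ((k + l == -1) && (i == j))%:R *: v,
          forall i j k l v,
            mode (ap i) k (mode (ap j) l v) = mode (ap j) l (mode (ap i) k v) &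
          forall i j k l v,
            mode (am i) k (mode (am j) l v) = mode (am j) l (mode (am i) k v)],
      forall i n, 0 <= n ->
        mode (ap i) n (vac V) = 0 /\ mode (am i) n (vac V) = 0,
      forall A, weyl_stable ap am A -> A (vac V) -> A = setT,
      vac V <> 0 &
      forall A, weyl_stable ap am A -> A = [set 0] \/ A = setT].

(* The even part M_1^0 of the copy of M_1 generated by bp and bm. *)
Definition weyl_even (V : vertexAlgebra C) (bp bm : V) : set V :=
  neg_fixed (generated [set bp; bm]) [set bp; bm].

Section Rank2.
Variables (V : vertexAlgebra C) (ap am : 'I_2 -> V).

Let a1p : V := ap ord0.
Let a2p : V := ap ord_max.
Let a1m : V := am ord0.
Let a2m : V := am ord_max.

Definition b1p : V := (sqrtC 2)^-1 *: (a1p + a2m).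
Definition b2p : V := ('i / sqrtC 2) *: (a1p - a2m).
Definition b1m : V := (sqrtC 2)^-1 *: (a1m - a2p).
Definition b2m : V := (- 'i / sqrtC 2) *: (a1m + a2p).

(* L(-1/2 Lambda_0) is M_1^0, and M_2 is the tensor product of the copies of M_1
   generated by b1p, b1m and by b2p, b2m. *)
Definition L_mhalf_tensor_L_mhalf : set V :=
  inner_tensor (weyl_even b1p b1m) (weyl_even b2p b2m).

(* L(-Lambda_0) in its realisation inside M_1^0 (x) M_1^0; mode (ap i) (-1) x is
   a_i^+(-1/2) x. *)
Definition L_mone : set V :=
  generated [set mode a1p (-1) a2m; mode a1m (-1) a2p;
                 - mode a1p (-1) a1m + mode a2p (-1) a2m].

Definition weylH : V := mode a1p (-1) a1m + mode a2p (-1) a2m.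

End Rank2.
End Weyl.

Section Heisenberg.
Variables (C : numClosedFieldType) (h : vectType C).

Definition nondegenerate_symmetric (form : h -> h -> C) : Prop :=
  [/\ forall x, scalar (form x), forall x y, form x y = form y x &
      forall x, (forall y, form x y = 0) -> x = 0].

(* S(h (x) t^-1 C[t^-1]), as the polynomial algebra on the basis of
   h (x) t^-1 C[t^-1] induced by the basis vbasis {:h} of h; the index (i, n)
   stands for (i-th basis vector) (x) t^(-n-1). *)
Notation heisenberg_fock := {malg C[{cmonom ('I_(\dim {:h}) * nat)%type}]}.

Definition fock_var (x : 'I_(\dim {:h}) * nat) : heisenberg_fock :=
  << ucm x >>.

(* iota x is the vector x(-1)1 and x(n) is mode (iota x) n. *)
Definition heisenberg_vertex_algebra (form : h -> h -> C)
    (W : vertexAlgebra C) (iota : {linear h -> W}) : Prop :=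
  [/\ forall x y (k l : int) w,
        mode (iota x) k (mode (iota y) l w)
        - mode (iota y) l (mode (iota x) k w)
        = ((k + l == 0)%:R * k%:~R * form x y) *: w,
      forall x n, 0 <= n -> mode (iota x) n (vac W) = 0 &
      exists phi : {linear heisenberg_fock -> W},
        [/\ bijective phi, phi 1 = vac W &
            forall i n p, phi (fock_var (i, n) * p)
              = mode (iota (vbasis {:h})`_i) (- n.+1%:Z) (phi p)]].

(* M_h(1)^+ *)
Definition heisenberg_plus (W : vertexAlgebra C) (iota : {linear h -> W})
    : set W := neg_fixed [set: W] (range iota).

End Heisenberg.

(* Main.v *)
Require Import Defs.
From HB Require Import structures.
From mathcomp Require Import all_boot all_order all_algebra.
From mathcomp Require Import complex boolp classical_sets functions reals.
From mathcomp Require Import finmap monalg zify ring.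
Set Implicit Arguments.
Unset Strict Implicit.
Unset Printing Implicit Defensive.
Import Order.TTheory GRing.Theory Num.Theory.
Local Open Scope classical_set_scope.
Local Open Scope ring_scope.

(** Let [e], [f], [h] be the currents of [sl_2] at level [-1] in [M_2] and [H]
    the Heisenberg field. The proof determines the commutant of [sl_2] in all of
    [M_2] first, and then intersects it with the even part of [M_1 (x) M_1].

    _The commutant in [M_2] is the Heisenberg algebra of [H]._ The conformal vector
    of [M_2] is the sum of the Sugawara vectors of [sl_2] and of [H]: the quartic
    terms cancel and the quadratic terms add up ([omega_split]). The Sugawara
    vector of [sl_2] acts by zero on the commutant, so there the conformal weight
    operator is [L = - 1/4 H_0^2 - 1/2 \sum_(k > 0) H_(-k) H_k]. Thus
    [L + 1/4 H_0^2] maps a commutant vector [v] to a combination of the vectors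
    [H_(-k) H_k v]. The [H_k v] have smaller weight and lie in the commutant, so
    by induction they belong to the space generated by [H]. On [M_2] the operator
    [L + 1/4 H_0^2] is diagonal with eigenvalues [weight + charge^2 / 4], which
    are positive except on the vacuum; hence it is invertible modulo that space
    and [v] itself belongs to it ([com_sl2_sub], [diagonal_absorb]).

    _Maps out of a Fock space._ Every homomorphism used below sends free generators
    to fields with the same brackets. Such a map exists because the creation
    monomials on the vacuum are linearly independent: a vector killed by all
    annihilation operators equals its constant term ([vacuum_comb]), so a linear
    relation among monomials can be differentiated down to degree zero
    ([comb_transfer], [free_extension]). This yields the embedding of [M_h(1)] in
    [M_2], the automorphism [-1] of [M_h(1)], and the two automorphisms of [M_2]
    which change the sign of one of the pairs [b_1^+-], [b_2^+-].

    _The even part._ Averaging over these two automorphisms shows that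
    [M_1^0 (x) M_1^0] is their common fixed space ([even_tensorE]). In terms of the
    [a_i^+-] each of them exchanges [a_1^+] with [a_2^-] and [a_1^-] with [a_2^+],
    up to signs, and maps [H] to [- H] ([reflection_H]). On the copy of [M_h(1)]
    generated by [H] both therefore restrict to the automorphism [-1], whose fixed
    points form [M_h(1)^+]. *)

(** * Consequences of the Borcherds identity *)

Section Modes.
Variables (C : numClosedFieldType) (V : vertexAlgebra C).
Implicit Types (u v w : V) (n p q r : int) (c : C).

HB.instance Definition _ u n :=
  GRing.isLinear.Build C V V *:%R (mode u n) (mode_linearr u n).

Lemma modeDl u v n w : mode (u + v) n w = mode u n w + mode v n w.
Proof. by have := mode_linearl n w 1 u v; rewrite !scale1r. Qed.

Lemma mode0l n w : mode (0 : V) n w = 0.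
Proof. by have /eqP := modeDl 0 0 n w; rewrite addr0 -subr_eq0 opprD addNKr oppr_eq0 => /eqP. Qed.

Lemma modeZl c u n w : mode (c *: u) n w = c *: mode u n w.
Proof. by have := mode_linearl n w c u 0; rewrite !addr0 mode0l addr0. Qed.

Lemma modeNl u n w : mode (- u) n w = - mode u n w.
Proof. by rewrite -scaleN1r modeZl scaleN1r. Qed.

Lemma mode0r u n : mode u n 0 = 0. Proof. exact: linear0. Qed.

Lemma modeDr u n v w : mode u n (v + w) = mode u n v + mode u n w.
Proof. exact: linearD. Qed.

Lemma modeNr u n v : mode u n (- v) = - mode u n v.
Proof. exact: linearN. Qed.

Lemma modeZr u n c v : mode u n (c *: v) = c *: mode u n v.
Proof. exact: linearZ. Qed.

Lemma mode_sumr u n k (F : 'I_k -> V) :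
  mode u n (\sum_i F i) = \sum_i mode u n (F i).
Proof. exact: linear_sum. Qed.

Lemma sum_trunc (W : zmodType) (F : nat -> W) K N :
  (K <= N)%N -> (forall i, (K <= i)%N -> F i = 0) ->
  \sum_(i < N) F i = \sum_(i < K) F i.
Proof.
move=> leKN F0; rewrite -!(big_mkord xpredT F) (big_cat_nat (n := K)) //=.
rewrite [X in _ + X](_ : _ = 0) ?addr0 // big_nat.
by apply: big1 => i /andP[leKi _]; exact: F0.
Qed.

Let posz0 : Posz 0 = 0. Proof. by []. Qed.

Lemma gbinom0 p : gbinom C p 0 = 1.
Proof. by rewrite /gbinom big_ord0 divr1. Qed.

Lemma gbinom1 p : gbinom C p 1 = p%:~R.
Proof. by rewrite /gbinom big_ord1 subr0 divr1. Qed.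

Lemma gbinom0S i : gbinom C 0 i.+1 = 0.
Proof. by rewrite /gbinom big_ord_recl subr0 !mul0r. Qed.

Lemma gbinomN1 i : gbinom C (-1) i = (-1) ^+ i.
Proof.
rewrite /gbinom; have -> : \prod_(j < i) (-1 - j%:Z)%:~R = (-1) ^+ i * (i`!)%:R :> C.
  elim: i => [|i IHi]; first by rewrite big_ord0 mulr1.
  rewrite big_ord_recr /= IHi exprS factS natrM.
  have -> : ((-1 - i%:Z)%:~R : C) = - i.+1%:R by rewrite -opprD -intS rmorphN.
  by ring.
by rewrite mulfK // pnatr_eq0 -lt0n fact_gt0.
Qed.

(** The case [r = 0] of the Borcherds identity. *)
Lemma mode_comm u v w p q K :
    (forall i : nat, (K <= i)%N -> mode u i v = 0) ->
  mode u p (mode v q w) - mode v q (mode u p w) =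
  \sum_(i < K) gbinom C p i *: mode (mode u i v) (p + q - i%:Z) w.
Proof.
move=> u0; have [N0 /(_ (maxn N0 K).+1)] := mode_borcherds u v w p q 0.
move/(_ (leqW (leq_maxl _ _))).
rewrite (sum_trunc (K := K)
   (F := fun i => gbinom C p i *: mode (mode u (0 + i%:Z) v) (p + q - i%:Z) w)).
- rewrite big_ord_recl [X in _ = _ + X -> _]big1 => [|i _]; last first.
    by rewrite lift0 gbinom0S mulr0 scale0r.
  rewrite /= !posz0 gbinom0 expr0z !addr0 ?subr0 mulr1 !scale1r => <-.
  by apply: eq_bigr => i _; rewrite add0r.
- exact/leqW/leq_maxr.
- by move=> i leKi; rewrite add0r u0 // mode0l scaler0.
Qed.

(** The case [p = 0] of the Borcherds identity. *)
Lemma mode_assoc u v w r q : exists N0 : nat, forall N, (N0 <= N)%N ->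
  mode (mode u r v) q w =
  \sum_(i < N) ((-1) ^+ i * gbinom C r i) *:
     (mode u (r - i%:Z) (mode v (q + i%:Z) w)
      - (-1) ^ r *: mode v (q + r - i%:Z) (mode u i w)).
Proof.
have [N0 HN0] := mode_borcherds u v w 0 q r.
exists N0.+1 => -[//|N] ltN; have := HN0 N.+1 (ltnW ltN).
rewrite big_ord_recl [X in _ + X = _ -> _]big1 => [|i _]; last by rewrite lift0 gbinom0S scale0r.
rewrite /= !posz0 gbinom0 !addr0 ?subr0 scale1r add0r => ->.
by apply: eq_bigr => i _; rewrite !add0r.
Qed.

(** The vector [u_(-2) 1] is the derivative of [u]. With [v] the vacuum, [r = - 2]
    and [q = 0], every term on the right of the Borcherds identity vanishes and
    only [i = 0, 1] survive on the left. *)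
Lemma mode_deriv u w p : mode (mode u (-2) (vac V)) p w = (- p)%:~R *: mode u (p - 1) w.
Proof.
have [N0 /(_ N0.+2 (leqW (leqW (leqnn _))))] := mode_borcherds u (vac V) w p 0 (-2).
rewrite [RHS]big1 => [|i _]; last first.
  rewrite !mode_vacl; have -> : (0 + i%:Z == -1) = false by lia.
  have -> : (0 - 2 - i%:Z == -1) = false by lia.
  by rewrite linear0 scaler0 subrr scaler0.
rewrite (sum_trunc (K := 2) (F := fun i => gbinom C p i *:
   mode (mode u (-2 + i%:Z) (vac V)) (p + 0 - i%:Z) w)) //; last first.
  by move=> i le2i; rewrite mode_vacr0 ?mode0l ?scaler0 //; lia.
rewrite !big_ord_recl big_ord0 /= !posz0 gbinom0 gbinom1 scale1r !addr0 ?subr0.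
have -> : -2 + (bump 0 0)%:Z = -1 by [].
rewrite mode_vacr => /eqP; rewrite addr_eq0 => /eqP ->.
by rewrite rmorphN scaleNr.
Qed.

End Modes.

(** * Subalgebras, commutants and homomorphisms *)

Section Subspaces.
Variables (C : numClosedFieldType) (V : vertexAlgebra C) (A : set V).
Hypothesis subA : is_subspace A.

Lemma subspace0 : A 0. Proof. by case: subA. Qed.

Lemma subspaceD u v : A u -> A v -> A (u + v).
Proof. by move=> Au Av; rewrite -[u]scale1r; case: subA => _; apply. Qed.

Lemma subspaceZ c u : A u -> A (c *: u).
Proof. by move=> Au; rewrite -[_ *: _]addr0; case: subA => A0; apply. Qed.

Lemma subspaceB u v : A u -> A v -> A (u - v).
Proof. by move=> Au Av; rewrite -scaleN1r; apply/subspaceD/subspaceZ. Qed.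

Lemma subspace_sum n (F : 'I_n -> V) : (forall i, A (F i)) -> A (\sum_i F i).
Proof. by move=> AF; apply: big_ind => //; [exact: subspace0|exact: subspaceD]. Qed.

End Subspaces.

Section Subalgebras.
Variables (C : numClosedFieldType) (V : vertexAlgebra C).
Implicit Types (u v w : V) (U A G : set V).

Lemma generated_subalgebra G : vertex_subalgebra (generated G).
Proof.
split.
- split=> [|c u v Gu Gv] X [[subX Xv Xm] GX]; first exact: subspace0.
  by case: (subX) => _; apply; [apply: (Gu X)|apply: (Gv X)].
- by move=> X [[subX Xv Xm] GX].
- by move=> u n v Gu Gv X HX; case: (HX) => -[_ _ Xm] _; apply: Xm; [exact: Gu|exact: Gv].
Qed.

Lemma sub_generated G : G `<=` generated G.
Proof. exact: sub_gen_smallest. Qed.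

Lemma generated_min G A : vertex_subalgebra A -> G `<=` A -> generated G `<=` A.
Proof. exact: smallest_sub. Qed.

Lemma linear_span_subspace G : is_subspace (linear_span G).
Proof.
split=> [|c u v Gu Gv] X [subX GX]; first exact: subspace0.
by case: (subX) => _; apply; [apply: (Gu X)|apply: (Gv X)].
Qed.

Lemma sub_linear_span G : G `<=` linear_span G.
Proof. exact: sub_gen_smallest. Qed.

Lemma linear_span_min G A : is_subspace A -> G `<=` A -> linear_span G `<=` A.
Proof. exact: smallest_sub. Qed.

Definition commuting u v :=
  forall m n w, mode u m (mode v n w) = mode v n (mode u m w).

Lemma commutingC u v : commuting u v -> commuting v u.
Proof. by move=> uv m n w; rewrite uv. Qed.

(** By the associativity formula, the modes of [u_r u'] are sums of products of
    modes of [u] and [u']. *)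
Lemma commuting_subalgebra v : vertex_subalgebra [set u | commuting u v].
Proof.
split; first split.
- by move=> m n w; rewrite !mode0l linear0.
- by move=> c u u' /= cu cu' m n w; rewrite !modeDl !modeZl modeDr modeZr cu cu'.
- by move=> m n w; rewrite !mode_vacl; case: eqP => // _; rewrite linear0.
- move=> u r u' /= cu cu' m n w.
  have [N1 /(_ (maxn N1 _) (leq_maxl _ _)) H1] := mode_assoc u u' (mode v n w) r m.
  have [N2 /(_ (maxn _ N2) (leq_maxr _ _)) H2] := mode_assoc u u' w r m.
  rewrite (H1 N2) (H2 N1) mode_sumr; apply: eq_bigr => i _.
  by rewrite modeZr modeDr modeNr modeZr !(cu, cu').
Qed.

(** Locality in its crudest form: by the commutator formula the bracket of two
    fields only involves their products of index at least 0. *)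
Lemma commutingP u v : commuting u v <-> forall n : int, 0 <= n -> mode u n v = 0.
Proof.
split=> [uv n n0|uv m n w].
  by rewrite -[v]mode_vacr uv mode_vacr0 // linear0.
apply/eqP; rewrite -subr_eq0 (@mode_comm _ _ _ _ _ _ _ 0) ?big_ord0 // => i _.
exact: uv.
Qed.

Lemma commuting_generated G v :
  (forall u, G u -> commuting u v) -> forall u, generated G u -> commuting u v.
Proof. by move=> Gv; apply: generated_min; first exact: commuting_subalgebra. Qed.

Lemma commutantE U A v :
  commutant U A v <-> A v /\ forall u, U u -> commuting u v.
Proof.
split=> -[Av Uv]; split=> // u Uu; first exact/commutingP/Uv.
by move=> n; move: (Uv _ Uu) => /commutingP; apply.
Qed.

Lemma commutant_subalgebra U A : vertex_subalgebra A -> vertex_subalgebra (commutant U A).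
Proof.
move=> [subA Avac Am].
have com u : vertex_subalgebra [set v | commuting v u] by apply: commuting_subalgebra.
split; first split.
- apply/commutantE; split=> [|u _]; first exact: subspace0.
  by apply: commutingC; have [/subspace0] := com u.
- move=> c v w /commutantE[Av Uv] /commutantE[Aw Uw]; apply/commutantE.
  split=> [|u Uu]; first by case: subA => _; apply.
  by apply: commutingC; have [[_ Dcom] _ _] := com u; apply: Dcom; apply: commutingC; auto.
- apply/commutantE; split=> // u _.
  by apply: commutingC; have [_ ? _] := com u.
- move=> v n w /commutantE[Av Uv] /commutantE[Aw Uw]; apply/commutantE.
  split=> [|u Uu]; first exact: Am.
  by apply: commutingC; have [_ _ Mcom] := com u; apply: Mcom; apply: commutingC; auto.
Qed.

End Subalgebras.

Section Homomorphisms.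
Variables (C : numClosedFieldType) (V V' : vertexAlgebra C).

Definition va_hom (F : {linear V -> V'}) :=
  F (vac V) = vac V' /\ forall u n v, F (mode u n v) = mode (F u) n (F v).

Definition cyclic (I : Type) (x : I -> V) := forall A : set V,
  is_subspace A -> A (vac V) ->
  (forall i n v, A v -> A (mode (x i) n v)) -> forall v, A v.

(** The map [f] is a homomorphism on [U] only, like the automorphisms that occur
    in [neg_fixed]. *)
Lemma hom_agree_subalgebra (F : {linear V -> V'}) (f : V -> V') (U : set V) :
  vertex_subalgebra U -> va_hom F -> f (vac V) = vac V' ->
  (forall c u v, U u -> U v -> f (c *: u + v) = c *: f u + f v) ->
  (forall u n v, U u -> U v -> f (mode u n v) = mode (f u) n (f v)) ->
  vertex_subalgebra [set u | U u /\ f u = F u].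
Proof.
move=> [subU Uvac Um] [Fvac Fm] fvac flin fm.
have U0 := subspace0 subU.
split; first split.
- split=> //; rewrite linear0; have := flin 1 0 0 U0 U0.
  by rewrite !scale1r addr0 => /eqP; rewrite -subr_eq subrr eq_sym => /eqP.
- move=> c u v [Uu fu] [Uv fv]; split; first by case: subU => _; apply.
  by rewrite flin // linearP fu fv.
- by rewrite /= Fvac.
- by move=> u n v [Uu fu] [Uv fv]; split; [exact: Um|rewrite fm // Fm fu fv].
Qed.

Section Cyclic.
Variables (I : Type) (x : I -> V).
Hypothesis cyc : cyclic x.

(** Over a cyclic vacuum it is enough to intertwine the modes of generators,
    because the associativity formula carries the property to every field. *)
Lemma hom_of_generators (F : {linear V -> V'}) (x' : I -> V') :
  F (vac V) = vac V' ->
  (forall i n v, F (mode (x i) n v) = mode (x' i) n (F v)) -> va_hom F.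
Proof.
move=> Fvac Fx; split=> // u.
suff : [set u | forall n v, F (mode u n v) = mode (F u) n (F v)] u by [].
have Fxi i : F (x i) = x' i by rewrite -[x i]mode_vacr Fx Fvac mode_vacr.
apply: cyc u; first split.
- by move=> n v; rewrite linear0 !mode0l linear0.
- by move=> c u v /= Fu Fv n w; rewrite linearP !modeDl !modeZl linearP Fu Fv.
- by move=> n v; rewrite Fvac !mode_vacl; case: eqP => // _; rewrite linear0.
- move=> i r u /= Fu q w; rewrite Fx.
  have [N1 /(_ (maxn N1 _) (leq_maxl _ _)) H1] := mode_assoc (x i) u w r q.
  have [N2 /(_ (maxn _ N2) (leq_maxr _ _)) H2] := mode_assoc (x' i) (F u) (F w) r q.
  rewrite (H1 N2) (H2 N1) linear_sum; apply: eq_bigr => k _.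
  by rewrite (linearZZ F) (linearB F) (linearZZ F) /= !(Fx, Fu).
Qed.

Lemma hom_agree (F G : {linear V -> V'}) :
  va_hom F -> va_hom G -> (forall i, F (x i) = G (x i)) -> F =1 G.
Proof.
move=> [Fv Fm] [Gv Gm] FG v.
suff : [set v | F v = G v] v by [].
apply: cyc v; first split; rewrite /= ?Fv ?Gv ?linear0 //.
- by move=> c u v /= Hu Hv; rewrite !linearP Hu Hv.
- by move=> i n v /= Hv; rewrite Fm Gm FG Hv.
Qed.

End Cyclic.
End Homomorphisms.

(** * Linear independence of creation monomials *)

Section Oscillators.
Variables (C : numClosedFieldType) (K : eqType).

Definition oscillators (W : lmodType C) (cr an : K -> W -> W) (Om : W) :=
  [/\ forall k, linear (cr k), forall k, linear (an k),
      forall k l w, cr k (cr l w) = cr l (cr k w),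
      forall k l w, an k (cr l w) = (k == l)%:R *: w + cr l (an k w) &
      forall k, an k Om = 0].

Section Monomials.
Variables (W : lmodType C) (cr : K -> W -> W) (Om : W).

Definition mon (s : seq K) : W := foldr cr Om s.

Definition comb (l : seq (C * seq K)) : W := \sum_(p <- l) p.1 *: mon p.2.

Lemma comb_cat l1 l2 : comb (l1 ++ l2) = comb l1 + comb l2.
Proof. by rewrite /comb big_cat. Qed.

Lemma comb_scale c l : comb [seq (c * p.1, p.2) | p <- l] = c *: comb l.
Proof.
by rewrite /comb big_map scaler_sumr; apply: eq_bigr => p _; rewrite scalerA.
Qed.

Lemma comb_mon s : comb [:: (1, s)] = mon s.
Proof. by rewrite /comb big_seq1 scale1r. Qed.

End Monomials.

(** Applying [an k] to a monomial removes each occurrence of [k] in turn. *)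
Fixpoint deriv_mon (k : K) (s : seq K) : seq (C * seq K) :=
  if s is a :: s' then
    ((k == a)%:R, s') :: [seq (p.1, a :: p.2) | p <- deriv_mon k s']
  else [::].

Definition deriv_comb k (l : seq (C * seq K)) :=
  flatten [seq [seq (p.1 * q.1, q.2) | q <- deriv_mon k p.2] | p <- l].

Definition const_coef (l : seq (C * seq K)) : C :=
  \sum_(p <- l) (p.2 == [::])%:R * p.1.

Definition degree_lt n (l : seq (C * seq K)) := all (fun p => size p.2 < n)%N l.

Lemma degree_lt0 l : degree_lt 0 l -> l = [::].
Proof. by case: l. Qed.

Lemma deriv_mon_lt k s : degree_lt (size s) (deriv_mon k s).
Proof.
elim: s => //= a s IHs; rewrite /degree_lt /= leqnn /= all_map.
by apply: sub_all IHs => p /= ltp; rewrite ltnS.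
Qed.

Lemma deriv_comb_lt k n l : degree_lt n.+1 l -> degree_lt n (deriv_comb k l).
Proof.
move=> /allP lown; apply/allP => q /flattenP[_ /mapP[p pl ->] /mapP[r rp ->]] /=.
have /allP/(_ _ rp) ltr := deriv_mon_lt k p.2.
by apply: leq_trans ltr _; rewrite -ltnS; exact: lown.
Qed.

Section Action.
Variables (W : lmodType C) (cr an : K -> W -> W) (Om : W).
Hypothesis osc : oscillators cr an Om.

Let cr0 k : cr k 0 = 0.
Proof.
case: osc => crl _ _ _ _; have := crl k 1 0 0.
by rewrite !scale1r addr0 => /eqP; rewrite -subr_eq subrr eq_sym => /eqP.
Qed.

Let crP k c u v : cr k (c *: u + v) = c *: cr k u + cr k v.
Proof. by case: osc => crl _ _ _ _; exact: crl. Qed.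

Let an0 k : an k 0 = 0.
Proof.
case: osc => _ anl _ _ _; have := anl k 1 0 0.
by rewrite !scale1r addr0 => /eqP; rewrite -subr_eq subrr eq_sym => /eqP.
Qed.

Let anP k c u v : an k (c *: u + v) = c *: an k u + an k v.
Proof. by case: osc => _ anl _ _ _; exact: anl. Qed.

Lemma comb_cr k l : cr k (comb cr Om l) = comb cr Om [seq (p.1, k :: p.2) | p <- l].
Proof.
elim: l => [|p l IHl]; first by rewrite /comb !big_nil cr0.
by rewrite /comb /= !big_cons crP -/(comb _ _ l) IHl.
Qed.

Lemma an_mon k s : an k (mon cr Om s) = comb cr Om (deriv_mon k s).
Proof.
case: osc => _ _ _ ancr anOm; elim: s => [|a s IHs] /=.
  by rewrite anOm /comb big_nil.
by rewrite ancr IHs comb_cr /comb big_cons.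
Qed.

Lemma an_comb k l : an k (comb cr Om l) = comb cr Om (deriv_comb k l).
Proof.
elim: l => [|p l IHl]; first by rewrite /comb !big_nil an0.
rewrite /deriv_comb /= comb_cat comb_scale -an_mon -/(deriv_comb k l) -IHl.
by rewrite /comb big_cons anP.
Qed.

(** [\sum_k cr k an k] is the Euler operator of a polynomial algebra. *)
Lemma euler_mon (F : seq K) s : uniq F -> {subset s <= F} ->
  \sum_(k <- F) cr k (an k (mon cr Om s)) = (size s)%:R *: mon cr Om s.
Proof.
move=> uF; case: osc => _ _ crC ancr anOm; elim: s => [|a s IHs] sF /=.
  by rewrite scale0r big1 // => k _; rewrite anOm cr0.
have cr_sum (G : K -> W) : cr a (\sum_(k <- F) G k) = \sum_(k <- F) cr a (G k).
  elim: F {IHs sF uF} => [|b F IHF]; first by rewrite !big_nil.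
  by rewrite !big_cons -[G b]scale1r crP IHF !scale1r.
under eq_bigr => k _ do rewrite ancr crP crC.
rewrite big_split /= -cr_sum IHs => [|b bs]; last by apply: sF; rewrite inE bs orbT.
rewrite (bigD1_seq a) ?sF ?mem_head //= eqxx scale1r big1 => [|k /negPf ->]; last first.
  by rewrite scale0r.
by rewrite -[_ *: mon _ _ s]addr0 crP cr0 !addr0 mulrS scalerDl scale1r.
Qed.

(** Iterating [1 - N / n], with [N] the Euler operator, kills the degrees [n],
    [n - 1], ..., [1] in turn and does not move a vector killed by every
    annihilation operator; what remains is the constant term. *)
Lemma vacuum_comb n l : degree_lt n.+1 l -> (forall k, an k (comb cr Om l) = 0) ->
  comb cr Om l = const_coef l *: Om.
Proof.
elim: n l => [|n IHn] l lowl vacl.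
  rewrite /comb /const_coef scaler_suml big_seq [RHS]big_seq; apply: eq_bigr => p pl.
  by have /allP/(_ p pl) := lowl; case: (p.2) => //= _; rewrite mul1r.
(* the terms of [(1 - N / n.+1) l]; those of degree [n.+1] have disappeared *)
pose l' := [seq (p.1 * ((n.+1%:R - (size p.2)%:R) / n.+1%:R), p.2) |
            p <- [seq p <- l | (size p.2 < n.+1)%N]].
have n_neq0 : n.+1%:R != 0 :> C by rewrite pnatr_eq0.
have topP p : p \in l -> ~~ (size p.2 < n.+1)%N -> size p.2 = n.+1.
  by have /allP lowP := lowl => /lowP /=; lia.
have ll' : comb cr Om l = comb cr Om l'.
  pose F := undup (flatten [seq p.2 | p <- l]).
  have eulerl : \sum_(k <- F) cr k (an k (comb cr Om l)) = 0.
    by rewrite big1 // => k _; rewrite vacl cr0.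
  have : comb cr Om l =
      comb cr Om l - n.+1%:R^-1 *: \sum_(k <- F) cr k (an k (comb cr Om l)).
    by rewrite eulerl scaler0 subr0.
  move=> ->; have -> : \sum_(k <- F) cr k (an k (comb cr Om l)) =
      \sum_(p <- l) (p.1 * (size p.2)%:R) *: mon cr Om p.2.
    have : {subset l <= l} by [].
    elim: {-2}l => [|p m IHm] sml.
      by rewrite /comb !big_nil big1 // => k _; rewrite an0 cr0.
    rewrite big_cons -IHm => [|q qm]; last by apply: sml; rewrite inE qm orbT.
    rewrite -scalerA -(@euler_mon F) ?undup_uniq // => [|k kp]; last first.
      rewrite mem_undup; apply/flattenP; exists p.2 => //.
      by apply: map_f; apply: sml; rewrite mem_head.
    rewrite scaler_sumr -big_split /=; apply: eq_bigr => k _.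
    by rewrite /comb big_cons anP crP.
  rewrite scaler_sumr /comb -sumrB [in RHS]big_map big_filter.
  rewrite [RHS]big_mkcond big_seq [RHS]big_seq; apply: eq_bigr => p pl.
  rewrite scalerA -scalerBl; case: ifP => [_|/negbT /(topP p pl) ->].
    by rewrite mulrBl divff // mulrBr mulr1 mulrCA (mulrC _^-1).
  by rewrite mulrCA mulVf // mulr1 subrr scale0r.
rewrite ll' IHn -?ll' //; last by apply/allP => _ /mapP[p + ->] /=; rewrite mem_filter => /andP[].
congr (_ *: _); rewrite /const_coef big_map big_filter big_mkcond.
rewrite big_seq [RHS]big_seq; apply: eq_bigr => p pl /=; case: ifP => [_|/negbT /(topP p pl)].
  by case: eqP => [->|_]; rewrite ?mul0r // subr0 divff // mulr1.
by case: (p.2) => //= *; rewrite mul0r.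
Qed.

End Action.

(** Linear relations between monomials are detected by the annihilation
    operators, hence do not depend on the module. *)
Lemma comb_transfer (W W' : lmodType C) cr an (Om : W) cr' an' (Om' : W') l :
  oscillators cr an Om -> oscillators cr' an' Om' -> Om <> 0 ->
  comb cr Om l = 0 -> comb cr' Om' l = 0.
Proof.
move=> osc osc' Om0.
have [n] : exists n, degree_lt n l.
  exists (\max_(p <- l) size p.2).+1; apply/allP => p pl.
  by rewrite ltnS (leq_bigmax_seq (F := fun p => size p.2) p).
elim: n l => [|n IHn] l lowl l0; first by rewrite (degree_lt0 lowl) /comb big_nil.
case: (osc) => _ anl _ _ _.
have an0 k : an k 0 = 0.
  by have /eqP := anl k 1 0 0; rewrite !scale1r addr0 -subr_eq subrr eq_sym => /eqP.
rewrite (vacuum_comb osc' lowl) => [|k].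
  have := vacuum_comb osc lowl; rewrite l0 => /(_ an0)/esym/eqP.
  by rewrite scaler_eq0 => /orP[/eqP ->|/eqP //]; rewrite scale0r.
rewrite (an_comb osc'); apply: IHn; first exact: deriv_comb_lt.
by rewrite -(an_comb osc) l0 an0.
Qed.

End Oscillators.

(** * Universality of free fields *)

Section FreeFields.
Variables (C : numClosedFieldType) (I : eqType) (g : I -> I -> int -> int -> C).

Definition free_fields (V : vertexAlgebra C) (x : I -> V) :=
  (forall i j k l v, mode (x i) k (mode (x j) l v) - mode (x j) l (mode (x i) k v)
     = g i j k l *: v) /\
  forall i n, 0 <= n -> mode (x i) n (vac V) = 0.

(** The mode dual to the creation operator [x_i (- n - 1)] is
    [kappa (i, n) x_(dual (i, n)) (deg (i, n))]. *)
Definition creation_dual (dual : I * nat -> I) (deg : I * nat -> nat)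
    (kappa : I * nat -> C) :=
  (forall i j (m n : nat), g i j (Negz m) (Negz n) = 0) /\
  forall k l, kappa k * g (dual k) l.1 (deg k) (Negz l.2) = (k == l)%:R.

Definition creation (V : vertexAlgebra C) (x : I -> V) (k : I * nat) : V -> V :=
  mode (x k.1) (Negz k.2).

Section OneAlgebra.
Variables (V : vertexAlgebra C) (x : I -> V).
Hypothesis ff : free_fields x.

Lemma free_swap i j k l v :
  mode (x i) k (mode (x j) l v) = g i j k l *: v + mode (x j) l (mode (x i) k v).
Proof. by case: ff => <- _; rewrite subrK. Qed.

Lemma free_oscillators dual deg kappa : creation_dual dual deg kappa ->
  oscillators (creation x)
    (fun k v => kappa k *: mode (x (dual k)) (deg k) v) (vac V).
Proof.
move=> [g0 gdual]; split.
- by move=> k c u v; rewrite /creation modeDr modeZr.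
- by move=> k c u v; rewrite modeDr modeZr scalerDr !scalerA mulrC.
- by move=> k l w; rewrite /creation free_swap g0 scale0r add0r.
- by move=> k l w; rewrite /creation free_swap scalerDr scalerA gdual modeZr.
- by case: ff => _ x0 k; rewrite x0 ?scaler0.
Qed.

(** Normal ordering: annihilation operators can be moved to the right until
    they reach the vacuum. *)
Lemma comb_span : cyclic x ->
  forall v, exists l, v = comb (creation x) (vac V) l.
Proof.
move=> cyc v; pose A := [set v | exists l, v = comb (creation x) (vac V) l].
suff: A v by []; have subA : is_subspace A.
  split=> [|c _ _ [l ->] [l' ->]]; first by exists [::]; rewrite /comb big_nil.
  by exists ([seq (c * p.1, p.2) | p <- l] ++ l'); rewrite comb_cat comb_scale.
have A_mon s : A (mon (creation x) (vac V) s).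
  by exists [:: (1, s)]; rewrite comb_mon.
have A_comb (f : V -> V) l : linear f -> (forall s, A (f (mon (creation x) (vac V) s))) ->
    A (f (comb (creation x) (vac V) l)).
  move=> flin Af; elim: l => [|p l IHl].
    rewrite /comb big_nil; have := flin 1 0 0; rewrite !scale1r addr0 => /eqP.
    by rewrite -subr_eq subrr eq_sym => /eqP ->; exact: subspace0.
  by rewrite /comb big_cons flin; case: subA => _; apply.
apply: cyc v => // [|i n v [l ->]]; first by exists [:: (1, [::])]; rewrite comb_mon.
apply: (A_comb) => [|s]; first exact: mode_linearr.
case: n => n; last exact: (A_mon ((i, n) :: s)).
elim: s => [|[j m] s IHs] /=; first by case: ff => _ ->; rewrite //; exact: subspace0.
rewrite /creation free_swap; apply: subspaceD => //.
  exact: subspaceZ (A_mon s).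
case: IHs => l0 ->; apply: A_comb => [|s']; first exact: mode_linearr.
exact: (A_mon ((j, m) :: s')).
Qed.

End OneAlgebra.

(** A cyclic system of free fields is universal: the Fock space has a basis of
    monomials, so generators may be sent to any fields with the same brackets. *)
Theorem free_extension (V V' : vertexAlgebra C) (x : I -> V) (x' : I -> V')
    dual deg kappa :
  creation_dual dual deg kappa -> free_fields x -> free_fields x' ->
  cyclic x -> vac V <> 0 ->
  exists F : {linear V -> V'}, [/\ va_hom F, forall i, F (x i) = x' i &
    vac V' <> 0 -> injective F].
Proof.
move=> gd ff ff' cyc vac0.
have osc := free_oscillators ff gd; have osc' := free_oscillators ff' gd.
pose cb := comb (creation x) (vac V); pose cb' := comb (creation x') (vac V').
have trans l l' : cb l = cb l' -> cb' l = cb' l'.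
  pose d := l ++ [seq (-1 * p.1, p.2) | p <- l'].
  have dE (W : lmodType C) (cr : I * nat -> W -> W) Om : comb cr Om d = comb cr Om l - comb cr Om l'.
    by rewrite comb_cat comb_scale scaleN1r.
  move=> ll'; have d0 : cb d = 0 by rewrite /cb dE -/(cb l) ll' subrr.
  by apply/eqP; rewrite -subr_eq0 -dE; apply/eqP; exact: comb_transfer osc osc' vac0 d0.
have spanl v : {l | v = cb l} by apply/cid/comb_span.
pose f v := cb' (sval (spanl v)).
have fE l : f (cb l) = cb' l by apply: trans; rewrite -(svalP (spanl (cb l))).
have flin : linear f.
  move=> c u v; rewrite {1}(svalP (spanl u)) {1}(svalP (spanl v)).
  by rewrite -comb_scale -comb_cat fE /cb' comb_cat comb_scale.
have [F FE] : exists F : {linear V -> V'}, forall l, F (cb l) = cb' l.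
  pose fL := GRing.isLinear.Build C V V' *:%R f flin.
  by exists (HB.pack f fL : {linear V -> V'}).
have Fvac : F (vac V) = vac V' by have := FE [:: (1, [::])]; rewrite /cb /cb' !comb_mon.
have Fcomb (i : I) n : (forall s, F (mode (x i) n (mon (creation x) (vac V) s)) =
    mode (x' i) n (mon (creation x') (vac V') s)) ->
    forall v, F (mode (x i) n v) = mode (x' i) n (F v).
  move=> Fmon v; rewrite (svalP (spanl v)); move: (sval _) => l; rewrite FE.
  elim: l => [|p l IHl]; first by rewrite /cb /cb' /comb !big_nil !mode0r linear0.
  rewrite /cb /cb' /comb !big_cons !modeDr !modeZr (linearD F) (linearZZ F) Fmon.
  by congr (_ + _); exact: IHl.
have Fmon s : F (mon (creation x) (vac V) s) = mon (creation x') (vac V') s.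
  by have := FE [:: (1, s)]; rewrite /cb /cb' !comb_mon.
have Fx i n v : F (mode (x i) n v) = mode (x' i) n (F v).
  case: n => n; apply: (Fcomb) => s; last exact: (Fmon ((i, n) :: s)).
  elim: s => [|[j m] s IHs] /=.
    by rewrite (proj2 ff) // (proj2 ff') // linear0.
  rewrite /creation (free_swap ff) (free_swap ff') (linearD F) (linearZZ F) -!/(creation _ _) Fmon.
  by congr (_ + _); rewrite Fcomb ?IHs // => s'; exact: (Fmon ((j, m) :: s')).
exists F; split.
- exact: hom_of_generators Fvac Fx.
- by move=> i; rewrite -[x i]mode_vacr Fx Fvac mode_vacr.
- move=> vac0' u v Fuv; apply/eqP; rewrite -subr_eq0; apply/eqP.
  have : F (u - v) = 0 by rewrite linearB /= Fuv subrr.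
  rewrite [u - v](svalP (spanl _)) FE => l0.
  exact: comb_transfer osc' osc vac0' l0.
Qed.

End FreeFields.

(** * Quadratic fields in the Weyl algebra *)

(** The generator [a_i^+-] has index [(s, i)], with [s = true] for the sign plus
    and [i = false], [true] for the first and the second pair. *)
Local Notation idx := (bool * bool)%type.

Section WeylFields.
Variable C : numClosedFieldType.

Definition weyl_bracket (p q : idx) (k l : int) : C :=
  ((k + l == -1) && (p.2 == q.2) && (p.1 != q.1))%:R * (-1) ^+ (~~ p.1).

Definition heisenberg_bracket (_ _ : unit) (k l : int) : C :=
  (k + l == 0)%:R * k%:~R * - 2.

Lemma weyl_creation_dual : creation_dual weyl_bracket
  (fun k => (~~ k.1.1, k.1.2)) (fun k => k.2) (fun k => (-1) ^+ k.1.1).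
Proof.
split=> [p q m n|[[s i] m] [[t k] n]] /=; rewrite /weyl_bracket.
  by have -> : (Negz m + Negz n == -1) = false by [lia]; rewrite mul0r.
rewrite mulrCA negbK -expr2 sqrr_sign mulr1 /=; congr (nat_of_bool _)%:R.
have -> : (Posz m + Negz n == -1) = (m == n) by lia.
by rewrite !xpair_eqE; case: s t i k (m == n) => [] [] [] [] [].
Qed.

Lemma heisenberg_creation_dual : creation_dual heisenberg_bracket
  (fun k => k.1) (fun k => k.2.+1) (fun k => (k.2.+1%:R * - 2)^-1).
Proof.
split=> [p q m n|[[] m] [[] n]] /=; rewrite /heisenberg_bracket.
  by have -> : (Negz m + Negz n == 0) = false by [lia]; rewrite !mul0r.
have -> : (Posz m.+1 + Negz n == 0) = (m == n) by lia.
rewrite xpair_eqE /= -mulrA mulrCA -pmulrn mulVf ?mulr1 //.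
by rewrite mulf_neq0 ?oppr_eq0 ?pnatr_eq0.
Qed.

Variables (V : vertexAlgebra C) (x : idx -> V).
Hypothesis ff : free_fields weyl_bracket x.

Definition bil p q : V := mode (x p) (-1) (x q).

Local Notation p1 := (true, false).
Local Notation m1 := (false, false).
Local Notation p2 := (true, true).
Local Notation m2 := (false, true).

Definition cur_e := bil p1 m2.
Definition cur_f := bil m1 p2.
Definition cur_h := - bil p1 m1 + bil p2 m2.
Definition cur_H := bil p1 m1 + bil p2 m2.

(** The conformal vector for which all generators have weight [1/2]. *)
Definition omega : V := 2^-1 *:
  (mode (x m1) (-2) (x p1) - mode (x p1) (-2) (x m1)
   + (mode (x m2) (-2) (x p2) - mode (x p2) (-2) (x m2))).

Let xvac p n : 0 <= n -> mode (x p) n (vac V) = 0.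
Proof. exact: (proj2 ff). Qed.

Lemma gen_gen r q n : 0 <= n ->
  mode (x r) n (x q) = weyl_bracket r q n (-1) *: vac V.
Proof.
by move=> n0; rewrite -[x q in LHS]mode_vacr (free_swap ff) xvac // mode0r addr0.
Qed.

Lemma gen_bil r p q n : 0 <= n -> mode (x r) n (bil p q) =
  weyl_bracket r p n (-1) *: x q + weyl_bracket r q n (-1) *: x p.
Proof.
by move=> n0; rewrite (free_swap ff) gen_gen // modeZr mode_vacr.
Qed.

Lemma weyl_bracket_neq r q n l : n + l != -1 -> weyl_bracket r q n l = 0.
Proof. by move=> /negPf nl; rewrite /weyl_bracket nl mul0r. Qed.

(** Quadratic fields act linearly on the generators. *)
Lemma gen_comm_bil r p q n m v :
  mode (x r) n (mode (bil p q) m v) = mode (bil p q) m (mode (x r) n v) +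
   (weyl_bracket r p 0 (-1) *: mode (x q) (n + m) v +
    weyl_bracket r q 0 (-1) *: mode (x p) (n + m) v).
Proof.
apply/eqP; rewrite addrC -subr_eq (@mode_comm _ _ _ _ _ _ _ 1) => [|i i1].
  by rewrite big_ord1 gbinom0 scale1r subr0 gen_bil // modeDl !modeZl.
by rewrite gen_bil // !weyl_bracket_neq ?scale0r ?addr0 //; lia.
Qed.

(** [a_i^+] and [a_i^-] are eigenvectors of [H_0] with eigenvalues [- charge]. *)
Definition charge (p : idx) : C := (-1) ^+ (~~ p.1).

Lemma gen_comm_H r n m v : mode (x r) n (mode cur_H m v) =
  mode cur_H m (mode (x r) n v) + charge r *: mode (x r) (n + m) v.
Proof.
rewrite /cur_H !modeDl modeDr !gen_comm_bil [LHS]addrACA; congr (_ + _).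
by case: r => [[] []]; rewrite /weyl_bracket /charge /=
  !(mul1r, mul0r, scale0r, add0r, addr0).
Qed.

Lemma H_comm_gen r n m v : mode cur_H m (mode (x r) n v) =
  mode (x r) n (mode cur_H m v) - charge r *: mode (x r) (n + m) v.
Proof. by rewrite gen_comm_H addrK. Qed.

Lemma H_gen q n : 0 <= n -> mode cur_H n (x q) = - charge q *: mode (x q) (n - 1) (vac V).
Proof.
move=> n0; rewrite -[x q in LHS]mode_vacr H_comm_gen [mode cur_H n _]mode_vacr0 //.
by rewrite mode0r sub0r scaleNr (addrC (-1)).
Qed.

Lemma H_bil p q n : p.1 != q.1 -> 0 <= n ->
  mode cur_H n (bil p q) = - ((n == 1) && (p.2 == q.2))%:R *: vac V.
Proof.
move=> pq n0; rewrite H_comm_gen H_gen // modeZr (addrC (-1)).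
have [->|n1] := eqVneq n 0.
  rewrite sub0r mode_vacr oppr0 scale0r -scalerBl.
  by case: p q pq => [[] i] [[] j] //= _; rewrite /charge ?(opprK, subrr, addNr) /= ?scale0r //;
    rewrite expr0 expr1 ?opprK ?subrr ?addNr scale0r.
rewrite xvac ?mode0r ?scaler0 ?sub0r; last by lia.
rewrite gen_gen; last by lia.
rewrite scalerA -scaleNr /weyl_bracket pq andbT; congr (- _ *: _).
have -> : (n - 1 - 1 == -1) = (n == 1) by lia.
by rewrite mulrCA -expr2 sqrr_sign mulr1.
Qed.

Lemma commuting_H_e : commuting cur_H cur_e.
Proof. by apply/commutingP => n n0; rewrite H_bil //= andbF oppr0 scale0r. Qed.

Lemma commuting_H_f : commuting cur_H cur_f.
Proof. by apply/commutingP => n n0; rewrite H_bil //= andbF oppr0 scale0r. Qed.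

Lemma commuting_H_h : commuting cur_H cur_h.
Proof.
by apply/commutingP => n n0; rewrite modeDr modeNr !H_bil //= addNr.
Qed.

Lemma H_free : free_fields heisenberg_bracket (fun _ : unit => cur_H).
Proof.
have HH n : 0 <= n -> mode cur_H n cur_H = (- 2 * (n == 1)%:R) *: vac V.
  move=> n0; rewrite modeDr !H_bil //= !andbT -scalerDl; congr (_ *: _).
  by rewrite mulNr mulr_natl -opprD.
split=> [[] [] k l v|_ n]; last exact: mode_vacr0.
rewrite (@mode_comm _ _ _ _ _ _ _ 2) => [|i i2]; last first.
  by rewrite HH //; have -> : (Posz i == 1) = false by [lia]; rewrite mulr0 scale0r.
rewrite !big_ord_recl big_ord0 gbinom1 !HH //= mulr0 scale0r mode0l scaler0 add0r addr0.
rewrite mulr1 modeZl mode_vacl /heisenberg_bracket.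
have -> : (k + l - 1 == -1) = (k + l == 0) by lia.
by case: eqP => _; rewrite ?scaler0 ?mul0r ?scale0r // scalerA mul1r.
Qed.

Lemma gen_omega r n : 0 <= n -> mode (x r) n omega =
  2^-1 *: ((n == 1)%:R *: x r - (n == 0)%:R *: mode (x r) (-2) (vac V)).
Proof.
move=> n0.
have gen_quad p q : mode (x r) n (mode (x p) (-2) (x q)) =
   weyl_bracket r p n (-2) *: x q + weyl_bracket r q n (-1) *: mode (x p) (-2) (vac V).
  by rewrite (free_swap ff) gen_gen // modeZr.
rewrite /omega modeZr !modeDr !modeNr !gen_quad; congr (_ *: _).
rewrite /weyl_bracket; have -> : (n - 2 == -1) = (n == 1) by lia.
have -> : (n - 1 == -1) = (n == 0) by lia.
by clear gen_quad; case: r => [[] []] /=; rewrite !(andbT, andbF) /= !(mul0r, scale0r, mulr1, add0r, addr0, sub0r, oppr0, subr0, expr0, expr1, mulrN, scaleNr, opprK, opprD) // addrC.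
Qed.

Lemma omega_gen r n v : mode omega 1 (mode (x r) n v) =
  mode (x r) n (mode omega 1 v) - (n%:~R + 2^-1) *: mode (x r) n v.
Proof.
apply/eqP; rewrite eq_sym subr_eq addrC -subr_eq; apply/eqP.
rewrite (@mode_comm _ _ _ _ _ _ _ 2) => [|i i2]; last first.
  by rewrite gen_omega //; have -> : (Posz i == 1) = false by [lia];
    have -> : (Posz i == 0) = false by [lia]; rewrite !scale0r subrr scaler0.
rewrite !big_ord_recl big_ord0 gbinom0 gbinom1 !gen_omega //=.
rewrite !scale0r !scale1r sub0r subr0 addr0 !modeZl modeNl mode_deriv.
rewrite subr0 addrK opprD rmorphD /= !rmorphN /=.
rewrite -scaleNr !scalerA -scalerDl; congr (_ *: _).
by field.
Qed.

(** The associativity formula with [r = q = - 1]; the modes of index at least 1 of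
    a generator kill a quadratic vector, so at most one contraction occurs. *)
Lemma bil_bil p q p' q' : mode (bil p q) (-1) (bil p' q') =
  mode (x p) (-1) (mode (x q) (-1) (bil p' q'))
  + mode (x q) (-2) (weyl_bracket p p' 0 (-1) *: x q' + weyl_bracket p q' 0 (-1) *: x p')
  + mode (x p) (-2) (weyl_bracket q p' 0 (-1) *: x q' + weyl_bracket q q' 0 (-1) *: x p').
Proof.
have [N0 /(_ N0.+2 (leqW (leqW (leqnn _)))) ->] := mode_assoc (x p) (x q) (bil p' q') (-1) (-1).
have bil0 r (i : int) : 0 < i -> mode (x r) i (bil p' q') = 0.
  by move=> i0; rewrite gen_bil ?ltW // !weyl_bracket_neq ?scale0r ?addr0 //; lia.
rewrite (@sum_trunc _ (fun i => ((-1) ^+ i * gbinom C (-1) i) *: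
   (mode (x p) (-1 - i%:Z) (mode (x q) (-1 + i%:Z) (bil p' q'))
    - (-1) ^ (-1) *: mode (x q) (-1 + -1 - i%:Z) (mode (x p) i (bil p' q')))) 2) //.
  rewrite !big_ord_recl big_ord0 /= !gbinomN1 -!expr2 !sqrr_sign !scale1r addr0.
  rewrite [mode (x p) (bump 0 0) _]bil0 // mode0r scaler0 subr0 !subr0 addr0.
  have -> : (-1 : C) ^ (-1) = -1 by rewrite exprN1 invrN1.
  by rewrite scaleN1r opprK (gen_bil _ _ _ (lexx 0)) (gen_bil q _ _ (lexx 0)).
move=> i i2; rewrite [mode (x p) i _]bil0 ?[mode (x q) (-1 + _) _]bil0; try lia.
by rewrite !mode0r scaler0 subrr scaler0.
Qed.

End WeylFields.

(** * The conformal vector of the Weyl algebra *)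

(** Identities between linear combinations of a fixed list of vectors are checked
    coefficientwise after both sides are written as values of [lin]. *)
Section LinearCombinations.
Variables (C : numClosedFieldType) (W : lmodType C) (vs : seq W).

Definition lin (c : nat -> C) : W := \sum_(i < size vs) c i *: vs`_i.

Lemma lin_atom i : (i < size vs)%N -> vs`_i = lin (fun j => (j == i)%:R).
Proof.
move=> lti; rewrite /lin (bigD1 (Ordinal lti)) //= eqxx scale1r big1 ?addr0 // => j.
by rewrite -val_eqE /= => /negPf ->; rewrite scale0r.
Qed.

Lemma linD c d : lin c + lin d = lin (fun i => c i + d i).
Proof. by rewrite /lin -big_split; apply: eq_bigr => i _; rewrite /= scalerDl. Qed.

Lemma linZ a c : a *: lin c = lin (fun i => a * c i).
Proof. by rewrite /lin scaler_sumr; apply: eq_bigr => i _; rewrite scalerA. Qed.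

Lemma linN c : - lin c = lin (fun i => - c i).
Proof. by rewrite -scaleN1r linZ /lin; apply: eq_bigr => i _; rewrite mulN1r. Qed.

Lemma lin_eq c d : (forall i, (i < size vs)%N -> c i = d i) -> lin c = lin d.
Proof. by move=> cd; apply: eq_bigr => i _; rewrite cd. Qed.

End LinearCombinations.

Section WeylConformal.
Variable C : numClosedFieldType.
Variables (V : vertexAlgebra C) (x : idx -> V).
Hypothesis ff : free_fields (@weyl_bracket C) x.
Local Notation p1 := (true, false).
Local Notation m1 := (false, false).
Local Notation p2 := (true, true).
Local Notation m2 := (false, true).
Local Notation bil := (bil x).
Local Notation e := (cur_e x).
Local Notation f := (cur_f x).
Local Notation h := (cur_h x).
Local Notation H := (cur_H x).
Local Notation omega := (omega x).

Definition omega_sl2 : V :=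
  2^-1 *: (mode e (-1) f + mode f (-1) e + 2^-1 *: mode h (-1) h).

Definition omega_H : V := - 4^-1 *: mode H (-1) H.

Lemma creation_swap p q m n v :
  mode (x p) (Negz m) (mode (x q) (Negz n) v) = mode (x q) (Negz n) (mode (x p) (Negz m) v).
Proof.
rewrite (free_swap ff) /weyl_bracket.
by have -> : (Negz m + Negz n == -1) = false by [lia]; rewrite mul0r scale0r add0r.
Qed.

Lemma bilC p q : bil p q = bil q p.
Proof.
by rewrite /bil -[x q in LHS]mode_vacr (creation_swap _ _ 0 0) mode_vacr.
Qed.

(** With [x_i = a_i^+ a_i^-], the quartic terms are [1/4 (x_1 + x_2)^2] for [sl_2]
    and its opposite for [H]. The quadratic terms from reordering are [3/4] and
    [- 1/4] times [2 omega]. *)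
Lemma omega_split : omega = omega_sl2 + omega_H.
Proof.
(* the quartic monomials, and the quadratic terms left by one contraction *)
pose qt p q p' q' := mode (x p) (-1) (mode (x q) (-1) (bil p' q')).
pose dq p q := mode (x p) (-2) (x q).
have bb p q p' q' : mode (bil p q) (-1) (bil p' q') = qt p q p' q'
  + (weyl_bracket C p p' 0 (-1) *: dq q q' + weyl_bracket C p q' 0 (-1) *: dq q p')
  + (weyl_bracket C q p' 0 (-1) *: dq p q' + weyl_bracket C q q' 0 (-1) *: dq p p').
  by rewrite bil_bil // !modeDr !modeZr.
have swap p q v : mode (x p) (-1) (mode (x q) (-1) v) = mode (x q) (-1) (mode (x p) (-1) v).
  exact: (creation_swap _ _ 0 0).
have qt1 : qt p1 m2 m1 p2 = qt p1 m1 p2 m2.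
  by rewrite /qt [bil p2 m2]bilC /bil (swap m2 m1).
have qt2 : qt m1 p2 p1 m2 = qt p1 m1 p2 m2.
  by rewrite /qt /bil (swap p2 p1) (swap m1 p1).
have qt3 : qt p2 m2 p1 m1 = qt p1 m1 p2 m2.
  by rewrite /qt /bil (swap m2 p1) (swap p2 p1) [mode (x m2) _ _]bilC /bil (swap p2 m1).
pose vs := [:: qt p1 m1 p2 m2; qt p1 m1 p1 m1; qt p2 m2 p2 m2;
               dq m1 p1; dq p1 m1; dq m2 p2; dq p2 m2].
have bm1 (p q : idx) : weyl_bracket C p q 0 (-1) =
    ((p.2 == q.2) && (p.1 != q.1))%:R * (-1) ^+ (~~ p.1) by [].
rewrite /omega_sl2 /omega_H /omega /cur_e /cur_f /cur_h /cur_H.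
rewrite !(modeDl, modeNl, modeDr, modeNr) !bb !bm1 /= qt1 qt2 qt3.
rewrite -!/(dq _ _).
rewrite (lin_atom (vs := vs) (i := 0) isT : qt p1 m1 p2 m2 = _).
rewrite (lin_atom (vs := vs) (i := 1) isT : qt p1 m1 p1 m1 = _).
rewrite (lin_atom (vs := vs) (i := 2) isT : qt p2 m2 p2 m2 = _).
rewrite (lin_atom (vs := vs) (i := 3) isT : dq m1 p1 = _).
rewrite (lin_atom (vs := vs) (i := 4) isT : dq p1 m1 = _).
rewrite (lin_atom (vs := vs) (i := 5) isT : dq m2 p2 = _).
rewrite (lin_atom (vs := vs) (i := 6) isT : dq p2 m2 = _).
rewrite expr0 expr1 !mul0r !scale0r !add0r !addr0 !(linZ, linD, linN).
by apply: lin_eq; do 7! [case=> [_|]; first by rewrite /=; field].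
Qed.

Lemma mode_omega_vac : mode omega 1 (vac V) = 0.
Proof. exact: mode_vacr0. Qed.

Hypothesis cyc : cyclic x.

(** The two sides differ by an operator on [v] that commutes with the modes of the
    generators and kills the vacuum. *)
Lemma omega_comm_H (k : nat) v :
  mode omega 1 (mode H k v) = mode H k (mode omega 1 v) - k%:R *: mode H k v.
Proof.
suff : [set v | mode omega 1 (mode H k v) =
  mode H k (mode omega 1 v) - k%:R *: mode H k v] v by [].
apply: cyc v; first split.
- by rewrite /= !mode0r scaler0 subr0.
- move=> c u v /= Hu Hv; rewrite !modeDr !modeZr Hu Hv.
  by rewrite scalerBr scalerDr opprD addrACA !scalerA (mulrC c).
- by rewrite /= mode_omega_vac mode0r mode_vacr0 // mode0r scaler0 subr0.
- move=> r n v /= Hv; rewrite !(H_comm_gen ff) !(omega_gen ff) !(modeDr, modeNr, modeZr).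
  rewrite !(omega_gen ff) Hv !(H_comm_gen ff) !(modeDr, modeNr, modeZr).
  pose vs := [:: mode (x r) n (mode H k (mode omega 1 v)); mode (x r) n (mode H k v);
    mode (x r) (n + k) (mode omega 1 v); mode (x r) (n + k) v].
  rewrite (lin_atom (vs := vs) (i := 0) isT : mode (x r) n (mode H k (mode omega 1 v)) = _).
  rewrite (lin_atom (vs := vs) (i := 1) isT : mode (x r) n (mode H k v) = _).
  rewrite (lin_atom (vs := vs) (i := 2) isT : mode (x r) (n + k) (mode omega 1 v) = _).
  rewrite (lin_atom (vs := vs) (i := 3) isT : mode (x r) (n + k) v = _).
  rewrite !(linZ, linD, linN) rmorphD /= -pmulrn.
  by apply: lin_eq; do 4! [case=> [_|]; first by rewrite /=; field].
Qed.

Local Notation monx := (mon (creation x) (vac V)).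

Definition weight (s : seq (idx * nat)) : C := \sum_(k <- s) (k.2%:R + 2^-1).

Definition total_charge (s : seq (idx * nat)) : int :=
  \sum_(k <- s) (-1) ^+ (~~ k.1.1).

Lemma omega_mon s : mode omega 1 (monx s) = weight s *: monx s.
Proof.
elim: s => [|k s IHs] /=; first by rewrite /weight big_nil scale0r mode_omega_vac.
rewrite /creation (omega_gen ff) IHs modeZr -scalerBl /weight big_cons.
by congr (_ *: _); rewrite NegzE rmorphN /= -pmulrn -natr1; field.
Qed.

Lemma H0_mon s : mode H 0 (monx s) = - (total_charge s)%:~R *: monx s.
Proof.
elim: s => [|k s IHs] /=.
  by rewrite /total_charge big_nil oppr0 scale0r mode_vacr0.
rewrite /creation (H_comm_gen ff) addr0 IHs modeZr -scalerBl /total_charge big_cons.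
by rewrite rmorphD opprD addrC /charge rmorphXn rmorphN.
Qed.

Lemma weight_ge0 s : 0 <= weight s.
Proof. by apply: sumr_ge0 => k _; rewrite addr_ge0 ?invr_ge0. Qed.

Lemma weight_gt0 k s : 0 < weight (k :: s).
Proof.
rewrite /weight big_cons; apply: ltr_wpDr; first exact: weight_ge0.
by apply: ltr_wpDl; rewrite ?invr_gt0.
Qed.

Definition reduced_eigenvalue s : C := weight s + 4^-1 * (total_charge s)%:~R ^+ 2.

(** On the commutant of [sl_2] this operator involves only the products
    [H_(-k) H_k] with [k > 0]. *)
Definition reduced_weight v := mode omega 1 v + 4^-1 *: mode H 0 (mode H 0 v).

Lemma reduced_weight_mon s : reduced_weight (monx s) = reduced_eigenvalue s *: monx s.
Proof.
rewrite /reduced_weight omega_mon H0_mon modeZr H0_mon !scalerA -mulrA mulrNN -expr2.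
by rewrite -scalerDl.
Qed.

Lemma reduced_weight_linear : linear reduced_weight.
Proof.
move=> c u v; rewrite /reduced_weight !(modeDr, modeZr) scalerDr [c *: (_ + _)]scalerDr.
by rewrite addrACA !scalerA (mulrC c).
Qed.

Lemma reduced_eigenvalue_eq0 s : reduced_eigenvalue s = 0 -> s = [::].
Proof.
case: s => // k s /eqP; rewrite gt_eqF //; apply: ltr_wpDr (weight_gt0 k s).
by rewrite mulr_ge0 ?invr_ge0 // -rmorphXn ler0z sqr_ge0.
Qed.

End WeylConformal.

(** Modulo a stable subspace [M], a diagonal operator can be inverted on every
    eigenvector with nonzero eigenvalue: subtracting the eigenvalue of the first
    term shortens the combination. *)
Lemma diagonal_absorb (C : numClosedFieldType) (V : vertexAlgebra C) (T : Type)
    (A : V -> V) (M : set V) (m : T -> V) (lam : T -> C) :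
  linear A -> is_subspace M -> (forall v, M v -> M (A v)) ->
  (forall t, A (m t) = lam t *: m t) -> (forall t, lam t = 0 -> M (m t)) ->
  forall l : seq (C * T), M (A (\sum_(p <- l) p.1 *: m p.2)) ->
  M (\sum_(p <- l) p.1 *: m p.2).
Proof.
move=> Alin subM AM Am lam0 l; have [n] : exists n, size l = n by exists (size l).
have A0 : A 0 = 0.
  by have /eqP := Alin 1 0 0; rewrite !scale1r addr0 -subr_eq subrr eq_sym => /eqP.
have AZ c v : A (c *: v) = c *: A v by rewrite -[c *: v]addr0 Alin A0 addr0.
have AD u v : A (u + v) = A u + A v by rewrite -[u]scale1r Alin !scale1r.
have Asum (l' : seq (C * T)) : A (\sum_(p <- l') p.1 *: m p.2) = \sum_(p <- l') (p.1 * lam p.2) *: m p.2.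
  elim: l' => [|p l' IHl']; first by rewrite !big_nil.
  by rewrite !big_cons Alin IHl' Am scalerA.
elim: n l => [|n IHn] [|p l] //=; first by rewrite big_nil => _ _; exact: subspace0.
move=> [szl]; set v := \sum_(q <- _) _ => MAv.
have [lamp|lamp] := eqVneq (lam p.2) 0.
  have vE : v = p.1 *: m p.2 + \sum_(q <- l) q.1 *: m q.2 by rewrite /v big_cons.
  rewrite vE; apply: subspaceD => //; first by apply: subspaceZ => //; exact: lam0.
  by apply: IHn => //; move: MAv; rewrite vE AD AZ Am lamp scale0r scaler0 add0r.
pose l' := [seq (q.1 * (lam q.2 - lam p.2), q.2) | q <- l].
have l'E : \sum_(q <- l') q.1 *: m q.2 = A v - lam p.2 *: v.
  rewrite /v Asum !big_cons big_map scalerDr opprD addrACA scaler_sumr -sumrB.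
  rewrite scalerA (mulrC (lam _)) subrr add0r; apply: eq_bigr => q _.
  by rewrite scalerA -scalerBl mulrBr (mulrC (lam _)).
have Mw : M (A v - lam p.2 *: v).
  rewrite -l'E; apply: IHn; first by rewrite size_map.
  rewrite l'E -scaleN1r AD !AZ scaleN1r; apply: subspaceB; first exact: subM.
    exact: AM.
  exact: subspaceZ.
rewrite -[v]scale1r -(mulVf lamp) -scalerA; apply: subspaceZ => //.
by rewrite -[_ *: v](subKr (A v)); apply: subspaceB.
Qed.

(** * The commutant of sl_2 in the Weyl algebra *)

Section Commutant.
Variable C : numClosedFieldType.
Variables (V : vertexAlgebra C) (x : idx -> V).
Hypothesis ff : free_fields (@weyl_bracket C) x.
Hypothesis cyc : cyclic x.
Local Notation e := (cur_e x).
Local Notation f := (cur_f x).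
Local Notation h := (cur_h x).
Local Notation H := (cur_H x).
Local Notation omega := (omega x).
Local Notation monx := (mon (creation x) (vac V)).

Definition lowering (ks : seq nat) v := foldr (fun k : nat => mode H k.+1) v ks.

Definition depth (ks : seq nat) := sumn [seq k.+1 | k <- ks].

Lemma lowering_linear ks : linear (lowering ks).
Proof.
move=> c u v; elim: ks => [//|k ks IHks] /=.
by rewrite IHks modeDr modeZr.
Qed.

Lemma omega_lowering ks s : mode omega 1 (lowering ks (monx s)) =
  (weight C s - (depth ks)%:R) *: lowering ks (monx s).
Proof.
elim: ks => [|k ks IHks] /=; first by rewrite omega_mon // subr0.
rewrite omega_comm_H // IHks modeZr -scalerBl; congr (_ *: _).
by rewrite /depth /= natrD opprD addrA addrAC.
Qed.

(** The weights of monomials are nonnegative and monomials span. *)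
Lemma eigen_neg_eq0 c v : mode omega 1 v = c *: v -> c < 0 -> v = 0.
Proof.
move=> vc c0; have [l vl] := comb_span ff cyc v; rewrite vl /comb.
apply: (@diagonal_absorb C V _ (fun w => mode omega 1 w - c *: w) [set 0]
  (fun s => monx s) (fun s => weight C s - c)).
- move=> a u w; rewrite modeDr modeZr scalerDr opprD addrACA scalerBr.
  by rewrite !scalerA (mulrC a).
- by split=> // a u w -> ->; rewrite scaler0 addr0.
- by move=> _ ->; rewrite /= mode0r scaler0 subr0.
- by move=> s; rewrite omega_mon // scalerBl.
- move=> s /eqP; rewrite subr_eq0 => /eqP ws.
  by have := le_lt_trans (weight_ge0 C s); rewrite ws => /(_ _ c0); rewrite ltxx.
- by rewrite /= -/(comb _ _ l) -vl vc subrr.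
Qed.

(** A measure that every [H_k] with [k > 0] decreases by [k]. *)
Definition depth_bounded d v := forall ks, (d < depth ks)%N -> lowering ks v = 0.

(** Beyond this depth the weight would become negative. *)
Lemma depth_bounded_mon s : depth_bounded (\sum_(k <- s) k.2.+1) (monx s).
Proof.
move=> ks lts; apply: eigen_neg_eq0 (omega_lowering ks s) _.
rewrite subr_lt0; apply: le_lt_trans (_ : (\sum_(k <- s) k.2.+1)%:R < _); last by rewrite ltr_nat.
rewrite natr_sum; apply: ler_sum => k _; rewrite -[k.2.+1%:R]natr1 lerD2l.
by rewrite invf_le1 // ler1n.
Qed.

Lemma depth_bounded_ex v : exists d, depth_bounded d v.
Proof.
have [l ->] := comb_span ff cyc v.
elim: l => [|p l [d IHd]].
  exists 0%N => ks _; have := lowering_linear ks 1 0 0.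
  by rewrite /comb big_nil !scale1r addr0 => /eqP; rewrite -subr_eq subrr eq_sym => /eqP.
exists (maxn (\sum_(k <- p.2) k.2.+1) d) => ks; rewrite gtn_max => /andP[lt1 lt2].
by rewrite /comb big_cons lowering_linear depth_bounded_mon // scaler0 add0r; exact: IHd.
Qed.

Definition com_sl2 : set V := commutant (generated [set e; f; h]) setT.

Lemma com_sl2_H : com_sl2 H.
Proof.
apply/commutantE; split=> //; apply: commuting_generated => u [[->|->]|->];
  apply: commutingC; [exact: commuting_H_e|exact: commuting_H_f|exact: commuting_H_h].
Qed.

Lemma com_sl2_subalgebra : vertex_subalgebra com_sl2.
Proof. by apply: commutant_subalgebra; split. Qed.

(** On the commutant the Sugawara vector of [sl_2] acts by zero, so the
    conformal weight operator is given by the Heisenberg field alone. *)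
Lemma com_sl2_omega v : com_sl2 v ->
  mode omega 1 v = - 4^-1 *: mode (mode H (-1) H) 1 v.
Proof.
move=> [_ com]; rewrite (omega_split ff) modeDl [mode (omega_sl2 x) _ _]com // ?add0r ?modeZl //.
have [subU Uvac Um] := generated_subalgebra [set e; f; h].
have [Ue Uf Uh] : [/\ generated [set e; f; h] e, generated [set e; f; h] f &
                    generated [set e; f; h] h].
  by split; apply: sub_generated; [left; left|left; right|right].
apply: (subspaceZ subU); apply: (subspaceD subU); last by apply: (subspaceZ subU); exact: Um.
by apply: (subspaceD subU); exact: Um.
Qed.

(** [(H_(-1) H)_1 = H_0^2 + 2 \sum_(k > 0) H_(-k) H_k]. *)
Lemma sugawara_mode (M : set V) v : is_subspace M ->
  (forall n w, M w -> M (mode H n w)) -> (forall k : nat, M (mode H k.+1 v)) ->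
  M (mode (mode H (-1) H) 1 v - mode H 0 (mode H 0 v)).
Proof.
move=> subM MH Mv.
have [N /(_ N.+1 (leqW (leqnn _))) ->] := mode_assoc H H v (-1) 1.
have -> : (-1 : C) ^ (-1) = -1 by rewrite exprN1 invrN1.
under eq_bigr => i _ do rewrite gbinomN1 -expr2 sqrr_sign scale1r scaleN1r opprK.
rewrite big_split /= -addrA; apply: subspaceD => //.
  by apply: subspace_sum => // i; apply: MH; rewrite (_ : 1 + i%:Z = i.+1) //; lia.
rewrite big_ord_recl /= addrAC subrr add0r; apply: subspace_sum => // i.
by apply: MH; exact: Mv.
Qed.

(** Lowering by the positive modes of [H] does not leave the commutant and ends
    in zero, so by induction they send [v] into [M]; then the operator
    [omega_1 + H_0^2 / 4] sends [v] into [M] as well. This operator is diagonal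
    with nonnegative eigenvalues, and only the vacuum has eigenvalue zero. *)
Lemma com_sl2_sub (M : set V) : is_subspace M -> M (vac V) ->
  (forall n w, M w -> M (mode H n w)) -> M `<=` com_sl2 -> com_sl2 `<=` M.
Proof.
move=> subM Mvac MH Mcom v.
have reducedM w : com_sl2 w -> (forall k : nat, M (mode H k.+1 w)) -> M (reduced_weight x w).
  move=> cw Mw; rewrite /reduced_weight com_sl2_omega //.
  rewrite scaleNr addrC -scalerBr -opprB scalerN -scaleNr.
  by apply: subspaceZ => //; apply: sugawara_mode.
have [d] := depth_bounded_ex v; move: d v.
elim/ltn_ind => d IHd v bv cv.
have Mv (k : nat) : M (mode H k.+1 v).
  have [ltk|lek] := ltnP d k.+1.
    have /= -> := bv [:: k]; first exact: subspace0.
    by rewrite /depth /= addn0.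
  apply: (IHd (d - k.+1)%N); first by lia.
    move=> ks; rewrite /depth => ltks.
    (* the last letter of a lowering word acts first *)
    have := bv (rcons ks k); rewrite /lowering foldr_rcons; apply.
    by rewrite /depth map_rcons sumn_rcons; lia.
  have [_ _ comm] := com_sl2_subalgebra; exact: comm com_sl2_H cv.
have [l vl] := comb_span ff cyc v.
rewrite vl; apply: (@diagonal_absorb C V _ (reduced_weight x) M (fun s => monx s)
   (@reduced_eigenvalue C)) => //.
- exact: reduced_weight_linear.
- by move=> w Mw; apply: reducedM => [|k]; [exact: Mcom|exact: MH].
- exact: reduced_weight_mon.
- by move=> s /reduced_eigenvalue_eq0 ->.
- by rewrite -/(comb _ _ l) -vl; exact: reducedM.
Qed.

End Commutant.

(** * Fixed points of involutions *)

Section Automorphisms.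
Variables (C : numClosedFieldType).

Lemma fixed_subalgebra (V : vertexAlgebra C) (F : {linear V -> V}) :
  va_hom F -> vertex_subalgebra [set v | F v = v].
Proof.
move=> [Fvac Fm]; split; first split.
- exact: linear0.
- by move=> c u v /= Fu Fv; rewrite linearP Fu Fv.
- exact: Fvac.
- by move=> u n v /= Fu Fv; rewrite Fm Fu Fv.
Qed.

(** The automorphism quantified over in [neg_fixed] is unique, so one known
    involution with the right values on [G] can be used in its place. *)
Lemma neg_fixedE (V : vertexAlgebra C) (U G : set V) (F : {linear V -> V}) :
  vertex_subalgebra U -> G `<=` U ->
  (forall A, vertex_subalgebra A -> G `<=` A -> U `<=` A) ->
  va_hom F -> (forall v, F (F v) = v) -> (forall g, G g -> F g = - g) ->
  forall v, neg_fixed U G v <-> U v /\ F v = v.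
Proof.
move=> sU GU minU hF FF FG v; split=> [[Uv [th [[_ thlin thvac thm] thG thv]]]|[Uv Fv]].
  split=> //; have sA := hom_agree_subalgebra sU hF thvac thlin thm.
  have [|_ /= <- //] := minU _ sA _ _ Uv.
  by move=> g Gg; split; [exact: GU|rewrite thG // FG].
have [subU Uvac Um] := sU; have [Fvac Fm] := hF.
have FU u : U u -> U (F u).
  apply: (minU [set u | U (F u)]) => [|g Gg /=]; last first.
    by rewrite FG // -scaleN1r; apply: (subspaceZ subU); exact: GU.
  split; first split; rewrite /= ?linear0 ?Fvac //; first exact: subspace0.
    by move=> c w w' /= Uw Uw'; rewrite linearP; case: subU => _; apply.
  by move=> w n w' /= Uw Uw'; rewrite Fm; exact: Um.
split=> //; exists F; split=> //; split=> //.
- split=> //; first by move=> w w' _ _ eqF; rewrite -(FF w) eqF FF.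
  by move=> w Uw; exists (F w); rewrite ?FF //; exact: FU.
by move=> c w w' _ _; rewrite linearP.
Qed.

Lemma va_isomorphic_image (V W : vertexAlgebra C) (F : {linear W -> V})
    (U : set V) (U' : set W) :
  va_hom F -> injective F -> vertex_subalgebra U -> vertex_subalgebra U' ->
  (forall v, U v <-> exists2 w, U' w & F w = v) -> va_isomorphic U U'.
Proof.
move=> [Fvac Fm] Finj sU sU' UE; split=> //.
have [f fF] : exists f : V -> W, cancel F f.
  exists (fun v => if pselect (exists w, F w = v) is left e then sval (cid e) else 0).
  move=> w; case: pselect => [e|[]]; last by exists w.
  by apply: Finj; case: (cid e).
exists f; split=> [|c u v|| u n v].
- split.
  + by move=> v /UE[w U'w <-]; rewrite /= fF.
  + by move=> u v /set_mem/UE[w _ <-] /set_mem/UE[w' _ <-]; rewrite !fF => ->.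
  + by move=> w U'w; exists (F w); rewrite /= ?fF //; apply/UE; exists w.
- by move=> /UE[w _ <-] /UE[w' _ <-]; rewrite -linearP !fF.
- by rewrite -Fvac fF.
- by move=> /UE[w _ <-] /UE[w' _ <-]; rewrite -Fm !fF.
Qed.

End Automorphisms.

(** * The generators of the two tensor factors *)

Section RotatedGenerators.
Variable C : numClosedFieldType.
Variables (V : vertexAlgebra C) (ap am : 'I_2 -> V).
Hypothesis weyl : weyl_vertex_algebra ap am.

Definition agen (p : idx) : V :=
  (if p.1 then ap else am) (if p.2 then ord_max else ord0).

Definition bgen (p : idx) : V :=
  match p with
  | (true, false) => b1p ap am | (false, false) => b1m ap am
  | (true, true) => b2p ap am | (false, true) => b2m ap am
  end.

Lemma agen_free : free_fields (@weyl_bracket C) agen.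
Proof.
case: weyl => [[pm pp mm] vac0 _ _ _]; split=> [p q k l v|[[] i] n n0]; last 2 first.
- by case: (vac0 (if i then ord_max else ord0) n n0).
- by case: (vac0 (if i then ord_max else ord0) n n0).
have ordE (i j : bool) :
  ((if i then ord_max else ord0 : 'I_2) == (if j then ord_max else ord0)) = (i == j).
  by case: i j => -[].
case: p q => [[] i] [[] j]; rewrite /agen /weyl_bracket /=.
- by rewrite pp subrr andbF mul0r scale0r.
- by rewrite pm ordE andbT expr0 mulr1.
- by rewrite -opprB pm ordE andbT (addrC k) (eq_sym i) expr1 mulrN1 scaleNr.
- by rewrite mm subrr andbF mul0r scale0r.
Qed.

Lemma agen_cyclic : cyclic agen.
Proof.
move=> A subA Avac Ax v; case: weyl => [_ _ cyc _ _].
suff -> : A = setT by [].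
apply: cyc => //; split=> // i n w Aw.
have : (i == ord0) || (i == ord_max) by case: i => -[|[]].
by case/orP => /eqP ->; split; [exact: (Ax (true, false))|exact: (Ax (false, false))|
  exact: (Ax (true, true))|exact: (Ax (false, true))].
Qed.

Definition bcoef (p : idx) : C :=
  (if p.2 then (if p.1 then 'i else - 'i) else 1) / sqrtC 2.

Definition bsign (p : idx) : C := if p.1 (+) p.2 then 1 else - 1.

(** The four definitions in a uniform shape: [b_i^s] mixes [a_1^s] with
    [a_2^(- s)]. *)
Lemma bgenE p : bgen p = bcoef p *: (agen (p.1, false) + bsign p *: agen (~~ p.1, true)).
Proof.
case: p => [[] []]; rewrite /bcoef /bsign /= /b1p /b1m /b2p /b2m /agen /=;
  by rewrite ?scale1r ?scaleN1r ?div1r.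
Qed.

Lemma bcoef_neq0 p : bcoef p != 0.
Proof.
have s2 : sqrtC 2 != 0 :> C by rewrite sqrtC_eq0 pnatr_eq0.
by rewrite /bcoef mulf_neq0 ?invr_eq0 //; case: p => [[] []] /=;
  rewrite ?oppr_eq0 ?neq0Ci ?oner_eq0.
Qed.

Lemma bcoef_pair s i : bcoef (s, i) * bcoef (~~ s, i) = 2^-1.
Proof.
rewrite /bcoef /= mulrACA -invfM -expr2 sqrtCK.
have ii : - 'i * 'i = 1 :> C by rewrite mulNr -expr2 sqrCi opprK.
by case: i s => -[] /=; rewrite ?[_ * - 'i]mulrC ?ii ?mulr1 mul1r.
Qed.

Lemma agen1E s : agen (s, false) =
  2^-1 *: ((bcoef (s, false))^-1 *: bgen (s, false) + (bcoef (s, true))^-1 *: bgen (s, true)).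
Proof.
rewrite !bgenE !scalerA !mulVf ?bcoef_neq0 // !scale1r addrACA /= -scalerDl.
have -> : bsign (s, false) + bsign (s, true) = 0.
  by case: s; rewrite /bsign /= ?subrr ?addNr.
by rewrite scale0r addr0 -[agen _ in RHS]scale1r -scalerDl scalerA mulVf ?scale1r ?pnatr_eq0.
Qed.

Lemma agen2E s : agen (~~ s, true) = (bsign (s, false) / 2) *:
  ((bcoef (s, false))^-1 *: bgen (s, false) - (bcoef (s, true))^-1 *: bgen (s, true)).
Proof.
rewrite !bgenE !scalerA !mulVf ?bcoef_neq0 // !scale1r opprD addrACA subrr add0r /= -scalerBl scalerA.
suff -> : bsign (s, false) / 2 * (bsign (s, false) - bsign (s, true)) = 1 by rewrite scale1r.
by case: s; rewrite /bsign /=; field.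
Qed.

(** The brackets of [a_1^s] and [a_2^(- s)] with their partners are opposite, so
    they add up in the bracket of [b_i^+] and [b_i^-], where the two signs [bsign]
    multiply to [- 1], and cancel in the bracket of [b_1^s] and [b_2^(- s)], where
    they multiply to [1]. *)
Lemma bgen_free : free_fields (@weyl_bracket C) bgen.
Proof.
have [abr avac] := agen_free; split=> [p q k l v|p n n0]; last first.
  by rewrite bgenE modeZl modeDl modeZl !avac // scaler0 addr0 scaler0.
have bilin (u u' w w' : V) a a' b b' :
   mode (a *: (u + a' *: u')) k (mode (b *: (w + b' *: w')) l v)
   - mode (b *: (w + b' *: w')) l (mode (a *: (u + a' *: u')) k v) =
   (a * b) *: ((mode u k (mode w l v) - mode w l (mode u k v))
     + b' *: (mode u k (mode w' l v) - mode w' l (mode u k v))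
     + a' *: (mode u' k (mode w l v) - mode w l (mode u' k v))
     + (a' * b') *: (mode u' k (mode w' l v) - mode w' l (mode u' k v))).
  rewrite !(modeZl, modeDl, modeZr, modeDr).
  pose vs := [:: mode u k (mode w l v); mode w l (mode u k v);
     mode u k (mode w' l v); mode w' l (mode u k v);
     mode u' k (mode w l v); mode w l (mode u' k v);
     mode u' k (mode w' l v); mode w' l (mode u' k v)].
  rewrite (lin_atom (vs := vs) (i := 0) isT : mode u k (mode w l v) = _).
  rewrite (lin_atom (vs := vs) (i := 1) isT : mode w l (mode u k v) = _).
  rewrite (lin_atom (vs := vs) (i := 2) isT : mode u k (mode w' l v) = _).
  rewrite (lin_atom (vs := vs) (i := 3) isT : mode w' l (mode u k v) = _).
  rewrite (lin_atom (vs := vs) (i := 4) isT : mode u' k (mode w l v) = _).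
  rewrite (lin_atom (vs := vs) (i := 5) isT : mode w l (mode u' k v) = _).
  rewrite (lin_atom (vs := vs) (i := 6) isT : mode u' k (mode w' l v) = _).
  rewrite (lin_atom (vs := vs) (i := 7) isT : mode w' l (mode u' k v) = _).
  rewrite !(linZ, linD, linN).
  by apply: lin_eq; do 8! [case=> [_|]; first by rewrite /=; ring].
rewrite !bgenE bilin !abr !scalerA -!scalerDl scalerA; congr (_ *: _).
case: p q => [s i] [t j]; rewrite /weyl_bracket /= !(andbT, andbF) !mul0r !mulr0 !addr0.
have [<-|st] := eqVneq s t; first by rewrite eqxx !andbF !(mul0r, mulr0, addr0).
have {st}-> : t = ~~ s by case: s t st => -[].
have -> : (~~ s != ~~ ~~ s) by case: s.
rewrite !andbT; case: (k + l == -1) => /=; last by rewrite !(mul0r, mulr0, addr0).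
have [<-|ij] := eqVneq i j.
  by rewrite bcoef_pair; case: s; case: i; rewrite /bsign /=; field.
by case: s i j ij => -[] -[] // _; rewrite /bsign /= expr0 expr1; ring.
Qed.

Lemma bgen_cyclic : cyclic bgen.
Proof.
move=> A subA Avac Ay; apply: agen_cyclic => // -[s i] n v Av.
have Ab a b p q : A (a *: mode (bgen p) n v + b *: mode (bgen q) n v).
  by apply: (subspaceD subA); apply: (subspaceZ subA); exact: Ay.
case: i; last first.
  rewrite agen1E modeZl modeDl !modeZl; exact/(subspaceZ subA)/Ab.
rewrite -[s]negbK agen2E modeZl modeDl modeNl !modeZl -scaleNr.
exact/(subspaceZ subA)/Ab.
Qed.

End RotatedGenerators.

(** * The even part of the tensor product *)

Section Reflections.
Variable C : numClosedFieldType.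
Variables (V : vertexAlgebra C) (ap am : 'I_2 -> V).
Hypothesis weyl : weyl_vertex_algebra ap am.
Local Notation a := (agen ap am).
Local Notation b := (bgen ap am).

Let vac_neq0 : vac V <> 0. Proof. by case: weyl. Qed.

(** [d = false] stands for the first tensor factor. *)
Definition reflection (d : bool) (F : {linear V -> V}) :=
  va_hom F /\ forall p, F (b p) = (-1) ^+ (p.2 == d) *: b p.

Lemma reflection_exists d : exists F, reflection d F.
Proof.
have free' : free_fields (@weyl_bracket C) (fun p => (-1) ^+ (p.2 == d) *: b p).
  split=> [p q k l v|p n n0]; last by rewrite modeZl (proj2 (bgen_free weyl)) // scaler0.
  rewrite !(modeZl, modeZr) scalerA [X in _ - X]scalerA (mulrC (_ ^+ (q.2 == d))) -scalerBr.
  rewrite (proj1 (bgen_free weyl)) scalerA; congr (_ *: _); rewrite /weyl_bracket.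
  case: p q => [s i] [t j] /=; have [<-|ij] := eqVneq i j.
    by rewrite -expr2 sqrr_sign mul1r.
  by rewrite andbF mul0r mulr0.
have [F [hF FE _]] := free_extension (weyl_creation_dual C) (bgen_free weyl) free'
  (bgen_cyclic weyl) vac_neq0.
by exists F.
Qed.

Section OneReflection.
Variables (d : bool) (F : {linear V -> V}).
Hypothesis refl : reflection d F.

Lemma reflection_invol v : F (F v) = v.
Proof.
have [[Fvac Fm] Fb] := refl.
pose G : {linear V -> V} := (F \o F)%FUN; pose I : {linear V -> V} := idfun.
suff : G =1 I by apply.
apply: (hom_agree (bgen_cyclic weyl)).
- split=> [|u n w]; first by rewrite /G /= !Fvac.
  by rewrite /G /= !Fm.
- by split.
- by move=> p; rewrite /G /I /= Fb linearZZ Fb scalerA -expr2 sqrr_sign scale1r.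
Qed.

(** On the original generators a reflection is, up to a common sign, the
    substitution [a_1^+ <-> a_2^-], [a_1^- <-> - a_2^+], which exchanges the two
    terms of [H] and changes their sign. *)
Lemma reflection_H : F (cur_H a) = - cur_H a.
Proof.
have [[Fvac Fm] Fb] := refl.
pose c : C := if d then 1 else -1.
have cc : c * c = 1 by rewrite /c; case: (d); rewrite ?mulrNN mulr1.
pose A s i := (bcoef C (s, i))^-1 *: b (s, i).
have FA1 s : F (A s false) = c *: A s false.
  by rewrite linearZZ Fb /= scalerA mulrC -scalerA /c; case: (d); rewrite ?expr0 ?expr1.
have FA2 s : F (A s true) = - c *: A s true.
  by rewrite linearZZ Fb /= scalerA mulrC -scalerA /c; case: (d); rewrite ?expr0 ?expr1 ?opprK.
have a1E s : a (s, false) = 2^-1 *: (A s false + A s true) by exact: agen1E.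
have a2E s : a (~~ s, true) = (bsign C (s, false) / 2) *: (A s false - A s true).
  exact: agen2E.
have sg2 s : bsign C (s, false) * bsign C (s, false) = 1.
  by case: s; rewrite /bsign /= ?mulrNN mulr1.
have F1 s : F (a (s, false)) = (c * bsign C (s, false)) *: a (~~ s, true).
  rewrite a2E a1E linearZZ linearD FA1 FA2 scaleNr -scalerBr !scalerA; congr (_ *: _).
  by rewrite -!mulrA [bsign _ _ * (_ * _)]mulrA sg2 mul1r mulrC.
have F2 s : F (a (~~ s, true)) = (c * bsign C (s, false)) *: a (s, false).
  rewrite a2E a1E linearZZ linearB FA1 FA2 scaleNr opprK -scalerDr !scalerA; congr (_ *: _).
  by rewrite mulrC mulrA.
have [F1p F1m F2p F2m] := And4 (F1 true) (F1 false) (F2 false) (F2 true).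
rewrite /= in F1p F1m F2p F2m.
rewrite /cur_H /bil linearD !Fm F1p F1m F2p F2m !(modeZl, modeZr) !scalerA.
rewrite /bsign /= !(mulr1, mulrN, mulNr) cc !scaleN1r opprD addrC.
by rewrite -!/(bil a _ _) !(@bilC _ _ _ (agen_free weyl) (false, _)).
Qed.

End OneReflection.

Definition factor (i : bool) : set V := generated [set b (true, i); b (false, i)].

Definition even_factor (i : bool) : set V := weyl_even (b (true, i)) (b (false, i)).

Lemma even_factorE d F u : reflection d F ->
  even_factor d u <-> factor d u /\ F u = u.
Proof.
move=> refl; have [hF Fb] := refl; apply: neg_fixedE => //.
- exact: generated_subalgebra.
- exact: sub_generated.
- exact: generated_min.
- exact: reflection_invol refl.
- by move=> g [->|->]; [move: (Fb (true, d))|move: (Fb (false, d))];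
    rewrite eqxx expr1 scaleN1r.
Qed.

Lemma reflection_fix_other d F u : reflection d F -> factor (~~ d) u -> F u = u.
Proof.
move=> [hF Fb]; apply: (generated_min (fixed_subalgebra hF)) => g.
by case=> ->; [move: (Fb (true, ~~ d))|move: (Fb (false, ~~ d))];
  rewrite (_ : (_ == d) = false) ?scale1r //; case: (d).
Qed.

Lemma reflection_factor d F i u : reflection d F -> factor i u -> factor i (F u).
Proof.
move=> [[Fvac Fm] Fb]; have [subU Uvac Um] := generated_subalgebra [set b (true, i); b (false, i)].
apply: (@generated_min _ _ _ [set u | factor i (F u)]) => [|g gi /=].
  split; first split.
  - by rewrite /= linear0; exact: subspace0 subU.
  - by move=> c v w /= Uv Uw; rewrite linearP; case: subU => _; apply.
  - by rewrite /= Fvac.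
  - by move=> v n w /= Uv Uw; rewrite Fm; exact: Um.
have [p -> ip] : exists2 p, g = b p & factor i (b p).
  by case: gi => ->; [exists (true, i)|exists (false, i)] => //; apply: sub_generated; [left|right].
by rewrite Fb; exact: subspaceZ subU _ _ ip.
Qed.

Lemma commuting_factors u w : factor false u -> factor true w -> commuting u w.
Proof.
have bb s t : commuting (b (s, false)) (b (t, true)).
  move=> m n v; rewrite (free_swap (bgen_free weyl)) /weyl_bracket /=.
  by rewrite andbF mul0r scale0r add0r.
move=> Uu Uw; move: u Uu; apply: commuting_generated => g Gg; apply: commutingC.
move: w Uw; apply: commuting_generated => g' Gg'; apply: commutingC.
by case: Gg Gg' => -> [] ->; exact: bb.
Qed.

(** Since the factors commute, a mode of the first one acts on [u_(-1) w] through
    [u] and a mode of the second one through [w]; hence these products span a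
    subspace stable under all generators. *)
Lemma span_factors v : inner_tensor (factor false) (factor true) v.
Proof.
have [sub1 vac1 mode1] := generated_subalgebra [set b (true, false); b (false, false)].
have [sub2 vac2 mode2] := generated_subalgebra [set b (true, true); b (false, true)].
have gen_in s i : factor i (b (s, i)) by case: s; apply: sub_generated; [left|right].
pose X := inner_tensor (factor false) (factor true).
have subX : is_subspace X by exact: linear_span_subspace.
have prodX u w : factor false u -> factor true w -> X (mode u (-1) w).
  by move=> Uu Uw; apply: sub_linear_span; exists u, w.
have stable (f : V -> V) : linear f ->
    (forall u w, factor false u -> factor true w -> X (f (mode u (-1) w))) ->
    forall w, X w -> X (f w).
  move=> flin fX; apply: (@linear_span_min _ _ _ [set w | X (f w)]); last first.
    by move=> _ [u [w [Uu Uw ->]]]; exact: fX.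
  split=> [|c u w /= Xu Xw]; last by rewrite flin; case: subX => _; apply.
  have /eqP := flin 1 0 0; rewrite !scale1r addr0 -subr_eq subrr eq_sym => /eqP f0.
  by rewrite /= f0; exact: subspace0 subX.
apply: (bgen_cyclic weyl subX) => [|[s i] n].
- by rewrite -(mode_vacr (vac V)); exact: prodX.
- apply: stable => [|u w Uu Uw]; first exact: mode_linearr.
  case: i; first by rewrite -(commuting_factors Uu (gen_in s true)); apply: prodX => //; exact: mode2 (gen_in s true) Uw.
  suff <- : mode (mode (b (s, false)) n u) (-1) w = mode (b (s, false)) n (mode u (-1) w).
    by apply: prodX => //; exact: mode1 (gen_in s false) Uu.
  have [N /(_ N.+1 (leqW (leqnn _))) ->] := mode_assoc (b (s, false)) u w n (-1).
  have b0 (k : nat) : mode (b (s, false)) k w = 0.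
    by have /commutingP := commuting_factors (gen_in s false) Uw; apply.
  have u0 (k : nat) : mode u k w = 0 by have /commutingP := commuting_factors Uu Uw; apply.
  rewrite big_ord_recl big1 => [|k _]; last first.
    rewrite (_ : -1 + (lift ord0 k)%:Z = (k : nat)%:Z); last by rewrite lift0; lia.
    by rewrite u0 b0 !mode0r scaler0 subr0 scaler0.
  rewrite /= gbinom0 expr0 mulr1 scale1r addr0 b0 mode0r scaler0 subr0.
  by rewrite [n - _]subr0 [-1 + _]addr0.
Qed.

(** An invariant vector equals its average over the group generated by the two
    reflections, and the average of [u_(-1) w] is the product of the even parts
    of [u] and [w]. *)
Lemma even_tensorE F1 F2 : reflection false F1 -> reflection true F2 ->
  forall v, inner_tensor (even_factor false) (even_factor true) v <->
    F1 v = v /\ F2 v = v.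
Proof.
move=> r1 r2 v; have [[h1 _] [h2 _]] := (r1, r2).
have [[F1vac F1m] [F2vac F2m]] := (h1, h2).
split.
  move: v; apply: linear_span_min.
    have [[s10 s1] _ _] := fixed_subalgebra h1.
    have [[s20 s2] _ _] := fixed_subalgebra h2.
    split=> [|c u w [f1u f2u] [f1w f2w]]; first by split.
    by split; [exact: s1|exact: s2].
  move=> _ [u [w [/(even_factorE _ r1)[Uu fu] /(even_factorE _ r2)[Uw fw] ->]]].
  by split; rewrite ?F1m ?F2m ?fu ?fw ?(reflection_fix_other r1 Uw) ?(reflection_fix_other r2 Uu).
move=> [f1v f2v]; pose X := inner_tensor (even_factor false) (even_factor true).
have subX : is_subspace X by exact: linear_span_subspace.
have -> : v = 4^-1 *: (v + F1 v + (F2 v + F2 (F1 v))).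
  rewrite f1v !f2v -[v]scale1r -!scalerDl scalerA; congr (_ *: _). by field.
move: v {f1v f2v} (span_factors v).
apply: (@linear_span_min _ _ _ [set v | X (4^-1 *: (v + F1 v + (F2 v + F2 (F1 v))))]).
  split=> [|c u w /= Xu Xw]; first by rewrite /= !linear0 !addr0 scaler0; exact: subspace0 subX.
  have -> : 4^-1 *: (c *: u + w + F1 (c *: u + w) + (F2 (c *: u + w) + F2 (F1 (c *: u + w)))) =
    c *: (4^-1 *: (u + F1 u + (F2 u + F2 (F1 u)))) + 4^-1 *: (w + F1 w + (F2 w + F2 (F1 w))).
    rewrite !linearP scalerA mulrC -scalerA -scalerDr; congr (_ *: _).
    by rewrite !scalerDr [RHS]addrACA; congr (_ + _); rewrite [RHS]addrACA.
  by case: subX => _; apply.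
move=> _ [u [w [Uu Uw ->]]] /=.
have F1w : F1 w = w by exact: reflection_fix_other r1 Uw.
have F2u : F2 u = u by exact: reflection_fix_other r2 Uu.
have F2F1u : F2 (F1 u) = F1 u.
  by apply: (reflection_fix_other r2); exact: reflection_factor r1 Uu.
rewrite !(F1m, F2m) F1w F2u F2F1u -!modeDl -modeDr.
have -> : 4^-1 *: mode (u + F1 u) (-1) (w + F2 w) =
  mode (2^-1 *: (u + F1 u)) (-1) (2^-1 *: (w + F2 w)).
  by rewrite modeZl modeZr scalerA -invfM -natrM.
have avg d F z : reflection d F -> factor d z -> even_factor d (2^-1 *: (z + F z)).
  move=> refl Uz; have [subU _ _] := generated_subalgebra [set b (true, d); b (false, d)].
  apply/(even_factorE _ refl); split.
    apply: (subspaceZ subU); apply: (subspaceD subU) => //.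
    exact: reflection_factor refl Uz.
  by rewrite linearZZ linearD (reflection_invol refl) addrC.
by apply: sub_linear_span; exists (2^-1 *: (u + F1 u)), (2^-1 *: (w + F2 w)); split; auto.
Qed.

Lemma tensor_subalgebra : vertex_subalgebra (inner_tensor (even_factor false) (even_factor true)).
Proof.
have [F1 r1] := reflection_exists false; have [F2 r2] := reflection_exists true.
have [[s1 v1 m1] [s2 v2 m2]] := (fixed_subalgebra (proj1 r1), fixed_subalgebra (proj1 r2)).
have E v := even_tensorE r1 r2 v.
split; first split.
- by apply/E; split; exact: linear0.
- move=> c u w /E[f1u f2u] /E[f1w f2w]; apply/E.
  by split; [case: s1|case: s2] => _; apply.
- by apply/E; split.
- by move=> u n w /E[f1u f2u] /E[f1w f2w]; apply/E; split; [exact: m1|exact: m2].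
Qed.

End Reflections.

(** * The Heisenberg algebra of rank one *)

(** Splits off one variable, for inductions on the degree of a monomial. *)
Lemma cmonom_factor (I : choiceType) (m : {cmonom I}) :
  m != mone -> exists i m', m = mmul (ucm i) m' /\ (mdeg m' < mdeg m)%N.
Proof.
move=> m1; have [i mi] : exists i, m i != 0%N.
  apply/not_existsP => m0; case/negP: m1; apply/cmP => i.
  by rewrite cm1; apply/eqP/negP => /negP/m0.
exists i, (divcm m (ucm i)).
have mE : m = mmul (ucm i) (divcm m (ucm i)).
  apply/eqP/cmP => k; rewrite cmM cmU divcmE ucmE subnKC //.
  by case: eqP => [<-|//]; rewrite lt0n.
by split=> //; rewrite {2}mE mdegM mdegU.
Qed.

Lemma malg_monomZ (C : numClosedFieldType) (K : monomType) (c : C) (m : K) :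
  << c *g m >> = c *: << m >> :> {malg C[K]}.
Proof. by apply/malgP => k; rewrite mcoeffZ !mcoeffU mulrnAr mulr1. Qed.

Lemma malg_monomM (C : numClosedFieldType) (K : monomType) (m m' : K) :
  << mmul m m' >> = << m >> * << m' >> :> {malg C[K]}.
Proof. by rewrite malgM_def fgmulUU mulr1. Qed.

Section HeisenbergFock.
Variables (C : numClosedFieldType) (h : vectType C) (form : h -> h -> C).
Variables (W : vertexAlgebra C) (iota : {linear h -> W}).
Hypothesis heis : heisenberg_vertex_algebra form iota.
Variable x0 : h.
Hypothesis line : forall x, exists c : C, x = c *: x0.
Hypothesis form_x0 : form x0 x0 = - 2.

Lemma heis_vac_neq0 : vac W <> 0.
Proof.
case: heis => _ _ [phi [[psi phiK _] phi1 _]] vac0.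
have : 1 = 0 :> {malg C[{cmonom ('I_(\dim {:h}) * nat)%type}]}.
  by rewrite -[LHS]phiK phi1 vac0 -(linear0 phi) phiK.
by apply/eqP; exact: oner_neq0.
Qed.

Lemma heis_free : free_fields (@heisenberg_bracket C) (fun _ : unit => iota x0).
Proof.
case: heis => br vac0 _; split=> [[] [] k l v|_ n n0]; last exact: vac0.
by rewrite br form_x0.
Qed.

(** Under the identification of [W] with the polynomial algebra, multiplication
    by a variable is a creation operator, so monomials are reached from [1]. *)
Lemma heis_cyclic : cyclic (fun _ : unit => iota x0).
Proof.
move=> A subA Avac Ax w; case: heis => _ _ [phi [[psi _ psiK] phi1 phiM]].
rewrite -[w]psiK; move: (psi w) => p {w}.
have Amon m c : A (phi << c *g m >>).
  rewrite malg_monomZ.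
  rewrite linearZZ; apply: (subspaceZ subA) => {c}.
  have [d] : exists d, (mdeg m < d)%N by exists (mdeg m).+1.
  elim: d m => // d IHd m ltd; have [->|m1] := eqVneq m mone.
    by rewrite -phi1 in Avac.
  have [[i n] [m' [mE ltm]]] := cmonom_factor m1.
  rewrite mE malg_monomM -/(fock_var _) phiM; have [c ->] := line (vbasis {:h})`_i.
  rewrite linearZZ modeZl; apply: (subspaceZ subA); apply: Ax tt _ _ _.
  by apply: IHd; exact: leq_trans ltm _.
rewrite [p]monalgE linear_sum; apply: big_ind => //; first exact: subspace0 subA.
by move=> u v; exact: subspaceD subA _ _.
Qed.

End HeisenbergFock.

(** * The isomorphism *)

Theorem theorem3 (R : realType)
    (M2 : vertexAlgebra R[i]) (ap am : 'I_2 -> M2)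
    (M2_weyl : weyl_vertex_algebra ap am)
    (h : vectType R[i]) (form : h -> h -> R[i])
    (form_nd : nondegenerate_symmetric form)
    (j : {linear h -> M2}) (j_inj : injective j)
    (j_line : range j = [set c *: weylH ap am | c in [set: R[i]]])
    (form_H : forall x : h, j x = weylH ap am -> form x x = - 2)
    (Mh : vertexAlgebra R[i]) (iota : {linear h -> Mh})
    (Mh_heis : heisenberg_vertex_algebra form iota) :
  va_isomorphic (commutant (L_mone ap am) (L_mhalf_tensor_L_mhalf ap am))
                (heisenberg_plus iota).
Proof.
have [x0 jx0] : exists x0, j x0 = weylH ap am.
  have : range j (weylH ap am) by rewrite j_line; exists 1; rewrite ?scale1r.
  by case=> x0 _ <-; exists x0.
have line x : exists c : R[i], x = c *: x0.
  have : range j (j x) by exists x.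
  by rewrite j_line => -[c _ cx]; exists c; apply: j_inj; rewrite linearZZ jx0.
have fx0 := form_H x0 jx0.
pose y := fun _ : unit => iota x0.
have Wfree : free_fields (@heisenberg_bracket _) y by exact: heis_free Mh_heis _ fx0.
have Wcyc : cyclic y by exact: heis_cyclic Mh_heis _ line.
have Wvac := heis_vac_neq0 Mh_heis.
have Vvac : vac M2 <> 0 by case: M2_weyl.
have afree := agen_free M2_weyl; have acyc := agen_cyclic M2_weyl.
pose H := cur_H (agen ap am).
have [g [hg gy /(_ Vvac) ginj]] := free_extension (heisenberg_creation_dual _) Wfree
  (H_free afree) Wcyc Wvac.
have Wfree' : free_fields (@heisenberg_bracket _) (fun _ : unit => - iota x0).
  split=> [[] [] k l v|[] n n0]; last by rewrite modeNl (proj2 Wfree tt) ?oppr0.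
  by rewrite !modeNl !modeNr !opprK (proj1 Wfree tt tt).
have [th [hth thy _]] := free_extension (heisenberg_creation_dual _) Wfree Wfree' Wcyc Wvac.
have thth w : th (th w) = w.
  pose G : {linear Mh -> Mh} := (th \o th)%FUN; pose I : {linear Mh -> Mh} := idfun.
  suff : G =1 I by apply.
  have [thvac thm] := hth; apply: (hom_agree Wcyc).
  - by split=> [|u n v]; rewrite /G /= ?thvac ?thm.
  - by split.
  - by move=> i; rewrite /G /= (thy i) linearN (thy i) opprK.
have heis_plusE w : heisenberg_plus iota w <-> th w = w.
  have -> : heisenberg_plus iota w <-> setT w /\ th w = w; last by split=> [[]|].
  apply: neg_fixedE => //.
  - move=> A [subA Avac Am] iA v _; apply: Wcyc => // -[] n u; apply: Am.
    by apply: iA; exists x0.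
  - by move=> _ [x _ <-]; have [c ->] := line x; rewrite !linearZZ (thy tt) scalerN.
have [F1 r1] := reflection_exists M2_weyl false.
have [F2 r2] := reflection_exists M2_weyl true.
have gF d F : reflection ap am d F -> forall w, F (g w) = g (th w).
  move=> r; have [[Fvac Fm] _] := r; have [gvac gm] := hg; have [thvac thm] := hth.
  pose G : {linear Mh -> M2} := (F \o g)%FUN; pose I : {linear Mh -> M2} := (g \o th)%FUN.
  suff : G =1 I by [].
  apply: (hom_agree Wcyc).
  - by split=> [|u n v]; rewrite /G /= ?gvac ?gm.
  - by split=> [|u n v]; rewrite /I /= ?thvac ?gvac ?thm ?gm.
  - by move=> i; rewrite /G /I /= (gy i) (thy i) linearN (gy i); exact: reflection_H r.
have [gvac gm] := hg.
have [[com0 comlin] comvac comm] := com_sl2_subalgebra (agen ap am).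
have gcom w : com_sl2 (agen ap am) (g w).
  pose A := [set w | com_sl2 (agen ap am) (g w)].
  apply: (Wcyc A) => [||i n u Au].
  - split; first by rewrite /A /= linear0.
    by move=> c u u' /= Au Au'; rewrite /A /= linearP; exact: comlin.
  - by rewrite /A /= gvac.
  - by rewrite /A /= gm gy; apply: comm => //; exact: com_sl2_H.
have comE v : com_sl2 (agen ap am) v -> exists w, g w = v.
  apply: (@com_sl2_sub _ _ _ afree acyc [set v | exists w, g w = v]).
  - split=> [|c _ _ [w <-] [w' <-]]; first by exists 0; rewrite linear0.
    by exists (c *: w + w'); rewrite linearP.
  - by exists (vac Mh).
  - by move=> n _ [w <-]; exists (mode (y tt) n w); rewrite gm gy.
  - by move=> _ [w <-].
have tensorE v : L_mhalf_tensor_L_mhalf ap am v <-> F1 v = v /\ F2 v = v.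
  exact: (even_tensorE M2_weyl r1 r2).
apply: (va_isomorphic_image hg ginj).
- apply: commutant_subalgebra; exact: (tensor_subalgebra M2_weyl).
- have -> : heisenberg_plus iota = [set w | th w = w].
    by apply/predeqP => w; exact: heis_plusE.
  exact: fixed_subalgebra.
- move=> v; split=> [[/tensorE[fv _] comv]|[w /heis_plusE thw <-]].
    have [w gw] : exists w, g w = v by apply: comE; split.
    by exists w => //; apply/heis_plusE/ginj; rewrite -(gF _ _ r1) gw.
  split; last by case: (gcom w).
  by apply/tensorE; rewrite (gF _ _ r1) (gF _ _ r2) thw.
Qed.
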